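(* Let $T$ be an estimated tensor in the class $\mathcal C$. For any $\rho\in[2,3]$, \[\log V^{\mathrm{c}}_\rho(T)\le\max_{P\in\mathrm{sdist}(T)}\Big[H(P_{\mathrm m})+\sum_{s\in\operatorname{supp}(T)}P(s)\log\mathrm{Val}_\rho(T_s)+\frac{\rho-2}{3}\,P_0\,H(\tilde P)\Big].\]
   Context: Logarithms base 2; $H$ is the Shannon entropy (with $0\log0=0$). Tensors are trilinear forms $\sum T_{xyz}xyz$ over a field on finite variable sets; equivalent tensors differ by bijective renamings of $x$-, $y$-, $z$-variables separately; $\langle n,m,p\rangle=\sum x_{ij}y_{jk}z_{ki}$, tensors equivalent to it are matrix multiplication tensors, of volume $nmp$. Partitioned tensor: $X=\bigsqcup_{i\in I}X_i$, $Y=\bigsqcup_{j\in J}Y_j$, $Z=\bigsqcup_{k\in K}Z_k$, $T=\sum_sT_s$ with each constituent $T_s$ a nonzero tensor over $X_i,Y_j,Z_k$ for an annotation $s=(i,j,k)$, distinct constituents having distinct annotations; $\operatorname{supp}(T)$ = annotations. $T^{\otimes N}$ is partitioned by products of parts; its constituent with index triple $(A,B,C)$ (where $((A_t,B_t,C_t))_t\in\operatorname{supp}(T)^N$) is $\bigotimes_tT_{(A_t,B_t,C_t)}$. Symmetric: $I=J=K$ and $T_{(i,j,k)}\approx T_{(j,k,i)}$. Partitioned restriction: zero all variables of some parts. Estimated: functions $\rho\mapsto\mathrm{Val}_\rho(T_s)\ge0$ on $[2,3]$, with $\mathrm{Val}_\rho(T_s)=\mathrm{Vol}(T_s)^{\rho/3}$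 when $T_s$ is a matrix multiplication tensor. $\operatorname{supp}_0(T)$ = annotations with $T_s$ a matrix multiplication tensor, $\operatorname{supp}_*(T)$ the rest. The class $\mathcal C$ consists of the symmetric partitioned tensors $T$ with $\operatorname{supp}(T)\subseteq\mathbb Z^3$ and $\operatorname{supp}_0(T)=\{(i,j,k)\in\operatorname{supp}(T): i=0\text{ or }j=0\text{ or }k=0\}$. Consistent sums: a pattern is $\pi:[N]\to\operatorname{supp}_*(T)\cup\{0\}$; a constituent with index triple $(A,B,C)$ conforms to $\pi$ if $(A_t,B_t,C_t)=\pi(t)$ when $\pi(t)\ne0$ and $(A_t,B_t,C_t)\in\operatorname{supp}_0(T)$ when $\pi(t)=0$; then its zero part is $\bigotimes_{\pi(t)=0}T_{(A_t,B_t,C_t)}$, a constituent of $T^{\otimes|\pi^{-1}(0)|}$. A sum $S$ of distinct constituents of $T^{\otimes N}$ is consistent if all conform to a common $\pi$ and the sum $S^{(0)}$ of their zero parts is equivalent to a matrix multiplication tensor; $\mathrm{Val}_\rho(S)=\mathrm{Vol}(S^{(0)})^{\rho/3}\prod_{\pi(t)\neq0}\mathrm{Val}_\rho(T_{\pi(t)})$. $S^{(0)}$ is coherent if there is a partition $\pi^{-1}(0)=\mathcal X\cup\mathcal Y\cup\mathcal Z$ such that every summand's index triple $(A,B,C)$ has $A_t=0$ for $t\in\mathcal X$, $B_t=0$ for $t\in\mathcal Y$, $C_t=0$ for $t\in\mathcal Z$. A consistent restriction of $T^{\otimes N}$: from a partitioned restriction $R$ of $T^{\otimes N}$, partition its constituents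 into classes each summing to a consistent sum, sums of distinct classes having pairwise disjoint $x$-, $y$-, $z$-variables. Coherent merging value: $V^{\mathrm c}_{\rho,N}(T)$ is the maximum of the total $\mathrm{Val}_\rho$ of the class sums over consistent restrictions of $T^{\otimes N}$ in which each class sum $S$ has coherent $S^{(0)}$, and $V^{\mathrm c}_\rho(T)=\lim_{N\to\infty}V^{\mathrm c}_{\rho,N}(T)^{1/N}$. Distributions: $\mathrm{sdist}(T)$ is the set of probability distributions $P$ on $\operatorname{supp}(T)$ with $P(i,j,k)=P(j,k,i)$. For such $P$: $P_0=\sum_{s\in\operatorname{supp}_0(T)}P(s)$; $P^*(s)=P(s)$ for $s\in\operatorname{supp}_*(T)$, $0$ otherwise; $P_{\mathrm m}(i)=\sum_{(i,j,k)\in\operatorname{supp}(T)}P(i,j,k)$, $P^*_{\mathrm m}(i)=\sum_{(i,j,k)}P^*(i,j,k)$; $\tilde P(0)=\frac{3}{2P_0}(P_{\mathrm m}(0)-\frac{P_0}{3})$ and $\tilde P(i)=\frac{3}{2P_0}(P_{\mathrm m}(i)-P^*_{\mathrm m}(i))$ for $i\neq0$. When $P_0=0$ the term $P_0H(\tilde P)$ is taken to be $0$.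
   Formalization: For symmetric T the estimates are also assumed cyclically invariant, Val_ρ(T_(i,j,k)) = Val_ρ(T_(j,k,i)); without this the bound fails, e.g. support {(1,2,3),(2,3,1),(3,1,2)} with values 10, 1, 1 gives V = 12 > 3·10^{1/3}. *)

(* Defs.v *)
From HB Require Import structures.
From mathcomp Require Import all_boot all_order all_algebra finmap.
From mathcomp Require Import all_classical all_reals all_analysis.

Set Implicit Arguments.
Unset Strict Implicit.
Unset Printing Implicit Defensive.

Import Order.TTheory GRing.Theory Num.Theory.
Import numFieldNormedType.Exports.

Local Open Scope classical_set_scope.
Local Open Scope ring_scope.

(* A tensor carries its three finite variable sets; in particular equivalence
   takes variables with only zero coefficients into account. *)
Record tensor (F : fieldType) := Tensor {
  xvar : finType;
  yvar : finType;
  zvar : finType;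
  coef : xvar -> yvar -> zvar -> F }.

Definition tequiv (F : fieldType) (T U : tensor F) : Prop :=
  exists (a : xvar T -> xvar U) (b : yvar T -> yvar U) (c : zvar T -> zvar U),
    [/\ bijective a, bijective b, bijective c
      & forall x y z, coef (a x) (b y) (c z) = coef x y z].

(* Cyclic exchange of the roles of the x-, y- and z-variables. *)
Definition trot (F : fieldType) (T : tensor F) : tensor F :=
  @Tensor F (yvar T) (zvar T) (xvar T) (fun y z x => coef x y z).

Definition tequiv_cyc (F : fieldType) (T U : tensor F) : Prop :=
  exists r : nat, tequiv (iter r (@trot F) T) U.

Definition mmult (F : fieldType) (n m p : nat) : tensor F :=
  @Tensor F ('I_n * 'I_m)%type ('I_m * 'I_p)%type ('I_p * 'I_n)%type
    (fun x y z => [&& x.2 == y.1, y.2 == z.1 & z.2 == x.1]%:R).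

Definition is_mm (F : fieldType) (T : tensor F) : Prop :=
  exists n m p, tequiv T (mmult F n m p).

(* The volume of a matrix multiplication tensor; it does not depend on the
   dimensions chosen, since (nmp)^2 is the product of the numbers of x-, y-
   and z-variables. *)
Definition vol (F : fieldType) (T : tensor F) : nat :=
  xget 0%N [set v | exists n m p, tequiv T (mmult F n m p) /\ v = (n * m * p)%N].

(* A partitioned tensor whose parts on the three sides are indexed by the same
   type I: the parts are the fibres of xpart, ypart, zpart, and the constituents
   are the nonzero restrictions of the form to a triple of parts. *)
Record ptensor (F : fieldType) (I : choiceType) := PTensor {
  pt_tensor :> tensor F;
  xpart : xvar pt_tensor -> I;
  ypart : yvar pt_tensor -> I;
  zpart : zvar pt_tensor -> I }.

Section Partitioned.
Variables (F : fieldType) (I : choiceType).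
Implicit Types (T : ptensor F I) (s : I * I * I) (E : {fset I * I * I}).

Definition constituent T s : tensor F :=
  @Tensor F {x : xvar T | xpart x == s.1.1} {y : yvar T | ypart y == s.1.2}
    {z : zvar T | zpart z == s.2}
    (fun x y z => coef (val x) (val y) (val z)).

(* The annotations s for which constituent T s is nonzero. *)
Definition supp T : {fset I * I * I} :=
  [fset (xpart u.1.1, ypart u.1.2, zpart u.2)
    | u : (xvar T * yvar T * zvar T)%type & coef u.1.1 u.1.2 u.2 != 0]%fset.

Definition supp0 T : {fset I * I * I} :=
  [fset s in supp T | `[< is_mm (constituent T s) >]]%fset.

Definition suppstar T : {fset I * I * I} :=
  [fset s in supp T | ~~ `[< is_mm (constituent T s) >]]%fset.

(* Variables of the sum of the constituents with annotation in E: all those of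
   the parts involved. *)
Definition sum_xvars T E : {set xvar T} :=
  [set x | has (fun s => s.1.1 == xpart x) E]%SET.
Definition sum_yvars T E : {set yvar T} :=
  [set y | has (fun s => s.1.2 == ypart y) E]%SET.
Definition sum_zvars T E : {set zvar T} :=
  [set z | has (fun s => s.2 == zpart z) E]%SET.

Definition constituent_sum T E : tensor F :=
  @Tensor F {x : xvar T | x \in sum_xvars T E}
    {y : yvar T | y \in sum_yvars T E} {z : zvar T | z \in sum_zvars T E}
    (fun x y z =>
      if (xpart (val x), ypart (val y), zpart (val z)) \in E
      then coef (val x) (val y) (val z) else 0).

(* Tensor power with factors indexed by J. *)
Definition tpow T (J : finType) : ptensor F {ffun J -> I} :=
  @PTensor F {ffun J -> I}
    (@Tensor F {ffun J -> xvar T} {ffun J -> yvar T} {ffun J -> zvar T}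
      (fun x y z => \prod_(t : J) coef (x t) (y t) (z t)))
    (fun x => [ffun t => xpart (x t)])
    (fun y => [ffun t => ypart (y t)])
    (fun z => [ffun t => zpart (z t)]).

End Partitioned.

(* Estimates are attached to annotations. *)
Record estimated (F : fieldType) (R : realType) := Estimated {
  et_tensor :> ptensor F int;
  est : R -> int * int * int -> R;
  est_ge0 : forall rho s, 2 <= rho <= 3 -> s \in supp et_tensor ->
    0 <= est rho s;
  est_mm : forall rho s, 2 <= rho <= 3 -> s \in supp0 et_tensor ->
    est rho s = (vol (constituent et_tensor s))%:R `^ (rho / 3) }.

Section MergingValue.
Variables (F : fieldType) (R : realType) (T : estimated F R).

(* T_(i,j,k) and T_(j,k,i) agree up to renaming of variables, where the roles of
   x, y, z may also be cyclically exchanged (for Coppersmith-Winograd tensors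
   the exchange is needed); being estimates of the same tensor, their estimates
   agree. *)
Definition symmetric : Prop :=
  forall i j k : int, (i, j, k) \in supp T ->
    tequiv_cyc (constituent T (i, j, k)) (constituent T (j, k, i)) /\
    forall rho : R, 2 <= rho <= 3 -> est T rho (i, j, k) = est T rho (j, k, i).

Definition classC : Prop :=
  symmetric /\
  supp0 T = [fset s in supp T | [|| s.1.1 == 0, s.1.2 == 0 | s.2 == 0]]%fset.

Section Power.
Variable N : nat.

Definition annot : choiceType :=
  ({ffun 'I_N -> int} * {ffun 'I_N -> int} * {ffun 'I_N -> int})%type.

(* None stands for the value 0 of a pattern. *)
Definition pattern := {ffun 'I_N -> option (int * int * int)}.
Implicit Types (pi : pattern) (E : {fset annot}) (s : annot).

Definition is_pattern pi : Prop :=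
  forall t u, pi t = Some u -> u \in suppstar T.

Definition conforms pi s : Prop :=
  forall t : 'I_N,
    if pi t is Some u then (s.1.1 t, s.1.2 t, s.2 t) = u
    else (s.1.1 t, s.1.2 t, s.2 t) \in supp0 T.

Definition zeros pi : finType := {t : 'I_N | pi t == None}.

Definition zero_annot pi s
  : {ffun zeros pi -> int} * {ffun zeros pi -> int} * {ffun zeros pi -> int} :=
  ([ffun t => s.1.1 (val t)], [ffun t => s.1.2 (val t)], [ffun t => s.2 (val t)]).

(* S^(0), for S the sum of the constituents with annotation in E. *)
Definition zero_sum pi E : tensor F :=
  constituent_sum (tpow T (zeros pi)) [fset zero_annot pi s | s in E]%fset.

Definition consistent pi E : Prop :=
  [/\ (E `<=` supp (tpow T 'I_N))%fset, is_pattern pi,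
      forall s, s \in E -> conforms pi s & is_mm (zero_sum pi E)].

Definition coherent pi E : Prop :=
  exists PX PY PZ : {set 'I_N},
    [/\ (PX :|: PY :|: PZ)%SET = [set t | pi t == None]%SET,
        [/\ [disjoint PX & PY]%B, [disjoint PY & PZ]%B & [disjoint PX & PZ]%B]
      & forall s, s \in E ->
        [/\ forall t, t \in PX -> s.1.1 t = 0,
            forall t, t \in PY -> s.1.2 t = 0
          & forall t, t \in PZ -> s.2 t = 0]].

Definition sum_val (rho : R) pi E : R :=
  (vol (zero_sum pi E))%:R `^ (rho / 3) *
  \prod_(t < N) (if pi t is Some u then est T rho u else 1).

(* RX, RY, RZ are the parts kept by the partitioned restriction and E c,
   for c < m, are the classes. *)
Definition coherent_restriction (m : nat)
    (E : 'I_m -> {fset annot}) (pi : 'I_m -> pattern) : Prop :=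
  exists RX RY RZ : {fset {ffun 'I_N -> int}},
    [/\ forall s, (exists c, s \in E c) <->
          [/\ s \in supp (tpow T 'I_N), s.1.1 \in RX, s.1.2 \in RY & s.2 \in RZ],
        forall c, E c != fset0,
        forall c d, c != d -> [disjoint E c & E d]%fset,
        forall c d, c != d ->
          [/\ [disjoint sum_xvars (tpow T 'I_N) (E c)
                      & sum_xvars (tpow T 'I_N) (E d)]%B,
              [disjoint sum_yvars (tpow T 'I_N) (E c)
                      & sum_yvars (tpow T 'I_N) (E d)]%B
            & [disjoint sum_zvars (tpow T 'I_N) (E c)
                      & sum_zvars (tpow T 'I_N) (E d)]%B]
      & forall c, consistent (pi c) (E c) /\ coherent (pi c) (E c)].

(* The set is finite and contains 0 (from the restriction that zeroes all the
   variables), so that the supremum is a maximum. *)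
Definition coherent_value_at (rho : R) : R :=
  sup [set v | exists (m : nat) (E : 'I_m -> {fset annot}) (pi : 'I_m -> pattern),
    coherent_restriction E pi /\ v = \sum_(c < m) sum_val rho (pi c) (E c)].

End Power.

Definition coherent_value (rho : R) : R :=
  limn (fun N => coherent_value_at N rho `^ (N%:R^-1)).

End MergingValue.

Section Distributions.
Variables (F : fieldType) (R : realType) (T : estimated F R).
Implicit Type P : int * int * int -> R.

Definition sdist : set (int * int * int -> R) :=
  [set P | [/\ forall s, 0 <= P s,
               forall s, s \notin supp T -> P s = 0,
               \sum_(s <- supp T) P s = 1
             & forall i j k, P (i, j, k) = P (j, k, i)]].

Definition log2 (x : R) : R := ln x / ln 2.

(* log 0 = -oo *)
Definition elog2 (x : R) : \bar R := (lne x%:E * ((ln 2)^-1)%:E)%E.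

(* For finitely supported p. *)
Definition entropy (p : int -> R) : R :=
  - \sum_(i \in [set: int]) p i * log2 (p i).

Definition mass0 P : R := \sum_(s <- supp0 T) P s.

Definition dstar P : int * int * int -> R :=
  fun s => if s \in suppstar T then P s else 0.

Definition marginal P (i : int) : R := \sum_(s <- supp T | s.1.1 == i) P s.

Definition dtilde P (i : int) : R :=
  3 / (2 * mass0 P) *
  (if i == 0 then marginal P 0 - mass0 P / 3
   else marginal P i - marginal (dstar P) i).

(* Values in \bar R because estimates may vanish; note that 0 * -oo = 0. If
   mass0 P = 0 then the last term is 0. *)
Definition objective (rho : R) P : \bar R :=
  ((entropy (marginal P))%:E
   + \sum_(s <- supp T) (P s)%:E * elog2 (est T rho s)
   + ((rho - 2) / 3 * (mass0 P * entropy (dtilde P)))%:E)%E.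

End Distributions.

(* Main.v *)
Require Import Defs.
From mathcomp Require Import all_boot all_order all_algebra finmap.
From mathcomp Require Import all_classical all_reals all_analysis.
From mathcomp Require Import ring lra.

(* Let [v] be the total value of a coherent restriction of T^(xN). Choose a
   class c with probability proportional to its value, then a uniformly random
   term x_ij y_jk z_ki of its matrix multiplication tensor <n,m,p>, and a
   uniformly random position t. The symmetrized law P of the annotation
   (A_t,B_t,C_t) satisfies log v <= N * objective(P), without any error term.
   Every x-variable of the class is hit equally often, so Jensen's inequality
   bounds log (nm) by the average of -log w, for any subprobability weight w on
   the x-variables; similarly for y and z, and log nmp is half of the sum of the
   three logarithms. One part of log nmp is bounded by the weights that share
   prod_t P_m(A_t) equally among the variables of a part, summed over all
   classes (the classes have disjoint index sequences); the remaining part,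
   (rho-2)/3 * log nmp, is bounded inside each class by the weights built from
   Ptilde at the zero positions where coherence does not force the index to
   be 0. The sizes of the parts cancel against the estimates of the matrix
   multiplication constituents, because vol(T_s)^2 = |X_i||Y_j||Z_k|.
   The limit defining the coherent value is 0 if it does not exist, so the
   bound for each N suffices. *)

Set Implicit Arguments.
Unset Strict Implicit.
Unset Printing Implicit Defensive.

Import Order.TTheory GRing.Theory Num.Theory.
Import numFieldNormedType.Exports.

Local Open Scope classical_set_scope.
Local Open Scope ring_scope.

(** * Inequalities for sums of logarithms *)

Section LogInequalities.
Variable R : realType.

Lemma ln_leB1 (x : R) : 0 < x -> ln x <= x - 1.
Proof.
by move=> x0; have := @le_ln1Dx R (x - 1); rewrite addrCA subrr addr0; apply; lra.
Qed.

Lemma ln_prod (I : Type) (r : seq I) (P : pred I) (f : I -> R) :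
  (forall i, P i -> 0 < f i) ->
  ln (\prod_(i <- r | P i) f i) = \sum_(i <- r | P i) ln (f i).
Proof.
move=> f0; suff [] : ln (\prod_(i <- r | P i) f i) = \sum_(i <- r | P i) ln (f i)
  /\ 0 < \prod_(i <- r | P i) f i by [].
elim/big_ind2: _ => [|x1 x2 y1 y2 [<- ?] [<- ?]|i /f0]; first by rewrite ln1.
  by rewrite lnM ?posrE// mulr_gt0.
by [].
Qed.

(** Jensen's inequality for [ln], from [ln t <= t - 1] at the ratio of [f x] to the mean of [f]. *)
Lemma sum_ln_le (W : finType) (f : W -> R) : (0 < #|W|)%N ->
  (forall x, 0 < f x) ->
  \sum_x ln (f x) <= #|W|%:R * (ln (\sum_x f x) - ln (#|W|%:R)).
Proof.
move=> /card_gt0P[w _] f0; set n : R := #|W|%:R; set s := \sum_x f x.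
have s0 : 0 < s.
  rewrite /s (bigD1 w)//= ltr_pwDl//; apply: sumr_ge0 => x _; exact: ltW.
have n0 : 0 < n by rewrite ltr0n; apply/card_gt0P; exists w.
have -> : n * (ln s - ln n) = \sum_(x : W) (ln s - ln n).
  by rewrite sumr_const; exact: mulr_natl.
rewrite -subr_le0 -sumrB.
suff h : \sum_x (f x * n / s - 1) = 0 :> R.
  rewrite -[leRHS]h; apply: ler_sum => x _.
  have := ln_leB1 (divr_gt0 (mulr_gt0 (f0 x) n0) s0).
  by rewrite ln_div ?posrE ?mulr_gt0// lnM ?posrE//; lra.
rewrite sumrB sumr_const -mulr_suml -mulr_suml -/s -/n.
by rewrite mulrAC divff ?gt_eqF// mul1r subrr.
Qed.

(** Jensen's inequality for the weights [f A / sz A], which share [f A] among the at most [sz A]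
    points over [A]; their total is at most the sum of [f] over [S]. *)
Lemma sum_ln_fiber_le (W : finType) (K : choiceType) (X : W -> K)
    (S : {fset K}) (f sz : K -> R) :
  (0 < #|W|)%N -> (forall x, X x \in S) -> (forall A, A \in S -> 0 <= f A) ->
  (forall x, 0 < f (X x)) -> (forall x, 0 < sz (X x)) ->
  (forall x, #|[set y | X y == X x]%SET|%:R <= sz (X x)) ->
  \sum_x (ln (f (X x)) - ln (sz (X x)))
    <= #|W|%:R * (ln (\sum_(A <- S) f A) - ln (#|W|%:R)).
Proof.
move=> W0 XS f0 fX sz0 szX.
rewrite (eq_bigr (fun x => ln (f (X x) / sz (X x)))); last first.
  by move=> x _; rewrite ln_div ?posrE.
have h0 x : 0 < f (X x) / sz (X x) by rewrite divr_gt0.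
apply: (le_trans (sum_ln_le W0 h0)); rewrite ler_wpM2l ?ler0n// lerB//.
have s0 : 0 < \sum_x f (X x) / sz (X x).
  have /card_gt0P[w _] := W0.
  by rewrite (bigD1 w)//= ltr_pwDl//; apply: sumr_ge0 => x _; exact: ltW.
have le_s : \sum_x f (X x) / sz (X x) <= \sum_(A <- S) f A.
  have -> : \sum_x f (X x) / sz (X x)
      = \sum_x \sum_(A <- S | A == X x) f A / sz A.
    apply: eq_bigr => x _.
    by rewrite -big_filter filter_pred1_uniq ?fset_uniq ?XS// big_seq1.
  rewrite (exchange_big_dep predT)//= big_seq [leRHS]big_seq ler_sum// => A AS.
  rewrite sumr_const.
  have [[x /eqP xA]|nx] := pselect (exists x, X x == A); last first.
    rewrite (@eq_card0 _ (fun x => A == X x)) ?mulr0n ?f0// => x.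
    by apply/negbTE/negP; rewrite unfold_in => /eqP ax; apply: nx; exists x;
        rewrite -ax.
  rewrite -xA -mulr_natr -mulrA ler_piMr ?f0 ?XS//.
  rewrite ler_pdivrMl// mulr1; apply: le_trans (szX x).
  rewrite ler_nat; apply: subset_leq_card; apply/fintype.subsetP => y.
  by rewrite !inE unfold_in eq_sym.
by rewrite ler_ln ?posrE//; exact: lt_le_trans le_s.
Qed.

(** Gibbs' inequality for unnormalized weights: termwise it is [ln (q / p) <= q / p - 1]. Where
    [p i = 0], the left side is 0 and the right side is [q i >= 0]. *)
Lemma gibbs (I : finType) (p q : I -> R) :
  (forall i, 0 <= p i) -> (forall i, 0 <= q i) -> (forall i, 0 < p i -> 0 < q i) ->
  \sum_i p i * (ln (q i) - ln (p i)) <= \sum_i q i - \sum_i p i.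
Proof.
move=> p0 q0 pq; rewrite -sumrB ler_sum// => i _.
have [->|pp] := eqVneq (p i) 0; first by rewrite mul0r subr0.
have {pp} pp : 0 < p i by rewrite lt_neqAle eq_sym pp p0.
have qp := pq _ pp.
rewrite -ln_div ?posrE// -(ler_pdivlMl _ _ pp).
by apply: (le_trans (ln_leB1 (divr_gt0 qp pp))); rewrite mulrBr mulVf ?gt_eqF// mulrC.
Qed.

(** Multiplying out the product of the sums over [D] gives one term for each sequence with values in
    [D], and the members of [S] are among these. *)
Lemma sum_prod_le1 (J : finType) (K : choiceType) (S : {fset {ffun J -> K}})
    (D : {fset K}) (p : J -> K -> R) :
  (forall t i, 0 <= p t i) -> (forall t, \sum_(i <- D) p t i <= 1) ->
  (forall A, A \in S -> forall t, A t \in D) ->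
  \sum_(A <- S) \prod_t p t (A t) <= 1.
Proof.
move=> p0 p1 SD.
apply: (@le_trans _ _ (\prod_t \sum_(i <- D) p t i)); last first.
  by apply: prodr_ile1 => t _; rewrite p1 andbT sumr_ge0.
rewrite (eq_bigr (fun t => \sum_(i : D) p t (val i))); last first.
  by move=> t _; rewrite big_seq_fsetE.
rewrite bigA_distr_bigA /=.
(* [h] forgets that the values lie in [D], so that the expanded product can be compared with the sum
   over [S]. *)
pose h (g : {ffun J -> D}) : {ffun J -> K} := [ffun t => val (g t)].
have hinj : injective h.
  by move=> g g' /ffunP e; apply/ffunP => t; apply/val_inj; have := e t; rewrite !ffunE.
pose H := [fset h g | g in {ffun J -> D}]%fset.
have -> : \sum_(g : {ffun J -> D}) \prod_t p t (val (g t))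
    = \sum_(A <- H) \prod_t p t (A t).
  rewrite big_imfset/=; last by move=> ? ? _ _; exact: hinj.
  by rewrite big_enum; apply: eq_bigr => g _; apply: eq_bigr => t _; rewrite ffunE.
rewrite [leRHS](bigID (mem S))/= [leLHS]big_seq.
rewrite -[X in _ <= X + _]big_filter; rewrite ler_wpDr//.
  by apply: sumr_ge0 => A _; apply: prodr_ge0.
rewrite -[leLHS]big_filter; rewrite le_eqVlt; apply/orP; left; apply/eqP.
apply: perm_big; apply: uniq_perm; rewrite ?filter_uniq ?fset_uniq// => A.
rewrite !mem_filter andbb; case AS : (A \in S) => //=; symmetry.
apply/imfsetP; exists [ffun t => FSetSub (SD _ AS t)] => //.
by apply/ffunP => t; rewrite !ffunE.
Qed.

End LogInequalities.

(** * Matrix multiplication classes *)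

Section MatrixMultiplicationClasses.
Variable F : fieldType.

Definition nonzero (U : tensor F) := exists x y z, coef (t:=U) x y z != 0.

Lemma nonzero_trot r (U : tensor F) : nonzero U -> nonzero (iter r (@trot F) U).
Proof.
by elim: r => //= r IH /IH[x [y [z c]]]; exists y, z, x.
Qed.

Lemma nonzero_tequiv (U V : tensor F) : tequiv U V -> nonzero U -> nonzero V.
Proof.
by move=> [a [b [c [_ _ _ h]]]] [x [y [z n]]]; exists (a x), (b y), (c z); rewrite h.
Qed.

Lemma tequiv_mmult_card (U : tensor F) n m p : tequiv U (mmult F n m p) ->
  [/\ #|xvar U| = (n * m)%N, #|yvar U| = (m * p)%N & #|zvar U| = (p * n)%N].
Proof.
move=> [a [b [c [ba bb bc _]]]].
by rewrite (bij_eq_card ba) (bij_eq_card bb) (bij_eq_card bc) /= !card_prod !card_ord.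
Qed.

Lemma vol_mmult (U : tensor F) : is_mm U ->
  exists n m p, tequiv U (mmult F n m p) /\ vol U = (n * m * p)%N.
Proof.
move=> [n [m [p e]]]; rewrite /vol; case: xgetP => [v -> //|/(_ (n * m * p)%N)[]].
by exists n, m, p.
Qed.

Lemma sqr_vol (U : tensor F) : is_mm U ->
  (vol U ^ 2 = #|xvar U| * #|yvar U| * #|zvar U|)%N.
Proof.
move=> /vol_mmult[n [m [p [/tequiv_mmult_card[-> -> ->] ->]]]].
by rewrite -mulnn; ring.
Qed.

Section PartSizes.
Variables (I : choiceType) (T : ptensor F I).

Definition xsize (i : I) : nat := #|[set x | xpart (p:=T) x == i]%SET|.
Definition ysize (i : I) : nat := #|[set x | ypart (p:=T) x == i]%SET|.
Definition zsize (i : I) : nat := #|[set x | zpart (p:=T) x == i]%SET|.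

Lemma suppP s : reflect (exists x y z, coef (t:=T) x y z != 0 /\
  s = (xpart x, ypart y, zpart z)) (s \in supp T).
Proof.
apply: (iffP (imfsetP _ _ _ _)) => [[[[x y] z] /= c ->]|[x [y [z [c ->]]]]].
  by exists x, y, z.
by exists (x, y, z).
Qed.

(** Expresses the support by a property that [tequiv] and [trot] preserve, so that the symmetry of
    the tensor acts on it. *)
Lemma supp_nonzero s : s \in supp T <-> nonzero (constituent T s).
Proof.
split=> [/suppP[x [y [z [c ->]]]]|[x [y [z c]]]].
  by exists (exist _ x (eqxx _)), (exist _ y (eqxx _)), (exist _ z (eqxx _)).
apply/suppP; exists (val x), (val y), (val z); split=> //.
by rewrite (eqP (valP x)) (eqP (valP y)) (eqP (valP z)); case: s {x y z c} => -[].
Qed.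

Lemma size_gt0 s : s \in supp T ->
  [/\ (0 < xsize s.1.1)%N, (0 < ysize s.1.2)%N & (0 < zsize s.2)%N].
Proof.
move=> /suppP[x [y [z [_ ->]]]] /=.
by split; apply/card_gt0P; [exists x|exists y|exists z]; rewrite inE.
Qed.

Lemma sqr_vol_constituent s : s \in supp0 T ->
  (vol (constituent T s) ^ 2 = xsize s.1.1 * ysize s.1.2 * zsize s.2)%N.
Proof.
rewrite !inE => /andP[_ /asboolP /sqr_vol ->] /=.
by rewrite !card_sig /xsize /ysize /zsize; congr (_ * _ * _)%N;
  apply: eq_card => ?; rewrite !inE.
Qed.

End PartSizes.

Lemma card_ffun_fibers (J V : finType) (K : choiceType) (f : V -> K) (B : J -> K) :
  #|[set g : {ffun J -> V} | [forall t, f (g t) == B t]]%SET|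
  = (\prod_t #|[set v | f v == B t]%SET|)%N.
Proof.
rewrite -big_enum -(big_map _ xpredT id).
rewrite -[RHS]foldrE -(card_family (fun t => mem [set v | f v == B t]%SET)).
apply: eq_card => g; rewrite !inE; apply/forallP/familyP => h t;
  by have := h t; rewrite inE.
Qed.

Section Class.
Variables (R : realType) (T : estimated F R) (N : nat) (pi : pattern N).

(* Extends an index sequence of the zero part by the indices which the pattern
   imposes at the other positions. *)
Definition extend (side : int * int * int -> int) (h : {ffun zeros pi -> int})
    : {ffun 'I_N -> int} :=
  [ffun t => if pi t is Some u then side u
             else if insub t is Some t' then h t' else 0].

Lemma extend_zero side h (t : zeros pi) : extend side h (val t) = h t.
Proof. by rewrite ffunE valK (eqP (valP t)). Qed.

(** At a zero position the extension records the part of [g w t], so the fibre over [A] injects into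
    the product of the parts [A t] over these positions. *)
Lemma card_extend (W V : finType) (part : V -> int) side
    (g : W -> {ffun zeros pi -> V}) (A : {ffun 'I_N -> int}) : injective g ->
  (#|[set w | extend side [ffun t => part (g w t)] == A]%SET|
   <= \prod_(t | pi t == None) #|[set v | part v == A t]%SET|)%N.
Proof.
move=> gi; rewrite (big_sub _ (fun t => #|[set v | part v == A t]%SET|)).
rewrite -(card_ffun_fibers part (fun t : zeros pi => A (val t))).
rewrite -(card_imset _ gi); apply: subset_leq_card; apply/fintype.subsetP => h.
move=> /imsetP[w]; rewrite inE => /eqP e ->; rewrite inE; apply/forallP => t.
by rewrite -e extend_zero ffunE.
Qed.

(** The variables of <n,m,p> are carried back along the equivalence to variables of the zero part;
    [X], [Y], [Z] record their full index sequences. Injectivity of the equivalence bounds the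
    fibres by the sizes of the parts. *)
Lemma mm_class (E : {fset annot N}) : consistent T pi E ->
  exists n m p (X : 'I_n * 'I_m -> {ffun 'I_N -> int})
    (Y : 'I_m * 'I_p -> {ffun 'I_N -> int})
    (Z : 'I_p * 'I_n -> {ffun 'I_N -> int}),
    [/\ vol (zero_sum T pi E) = (n * m * p)%N,
        forall i j k, (X (i, j), Y (j, k), Z (k, i)) \in E &
        [/\ forall A, (#|[set w | X w == A]%SET|
              <= \prod_(t | pi t == None) xsize T (A t))%N,
            forall A, (#|[set w | Y w == A]%SET|
              <= \prod_(t | pi t == None) ysize T (A t))%N
          & forall A, (#|[set w | Z w == A]%SET|
              <= \prod_(t | pi t == None) zsize T (A t))%N]].
Proof.
move=> [_ _ conf mmE].
have [n [m [p [[a [b [c [[a' aK a'K] [b' bK b'K] [c' cK c'K] h]]]] ->]]]] :=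
  vol_mmult mmE.
exists n, m, p.
exists (fun w => extend (fun u => u.1.1) [ffun t => xpart (val (a' w) t)]).
exists (fun w => extend (fun u => u.1.2) [ffun t => ypart (val (b' w) t)]).
exists (fun w => extend (fun u => u.2) [ffun t => zpart (val (c' w) t)]).
split=> //.
  move=> i j k.
  (* This term has coefficient 1 in <n,m,p>, so its triple of parts must be the zero annotation of
     some [s] in [E]. *)
  have := h (a' (i, j)) (b' (j, k)) (c' (k, i)).
  rewrite a'K b'K c'K /= !eqxx /=; case: ifP => [|_ /eqP]; last by rewrite oner_eq0.
  move=> /imfsetP[s sE es _].
  move: es; rewrite /zero_annot => -[ex ey ez].
  suff <- : s = (extend (fun u => u.1.1) [ffun t => xpart (val (a' (i, j)) t)],
     extend (fun u => u.1.2) [ffun t => ypart (val (b' (j, k)) t)],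
     extend (fun u => u.2) [ffun t => zpart (val (c' (k, i)) t)]) by [].
  (* Conformity fixes [s] at the other positions, so [s] is determined by its zero annotation. *)
  have cs := conf _ sE.
  case: s ex ey ez cs {sE} => -[A B] C /= ex ey ez cs.
  congr (_, _, _); apply/ffunP => t; rewrite !ffunE; have := cs t;
    case ep: (pi t) => [u|] /=; try by move=> <-.
  - move=> _; case: insubP => [t' _ et|]; last by rewrite ep.
    by rewrite -et; have /ffunP/(_ t') := ex; rewrite !ffunE.
  - move=> _; case: insubP => [t' _ et|]; last by rewrite ep.
    by rewrite -et; have /ffunP/(_ t') := ey; rewrite !ffunE.
  - move=> _; case: insubP => [t' _ et|]; last by rewrite ep.
    by rewrite -et; have /ffunP/(_ t') := ez; rewrite !ffunE.
split=> A; apply: card_extend; apply: inj_comp; try exact: val_inj.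
- exact: can_inj a'K.
- exact: can_inj b'K.
- exact: can_inj c'K.
Qed.

End Class.

End MatrixMultiplicationClasses.

(** * Cyclic symmetry of supports and estimates *)

Definition srot (s : int * int * int) : int * int * int := (s.1.2, s.2, s.1.1).

Lemma srot3 s : srot (srot (srot s)) = s.
Proof. by case: s => -[]. Qed.

Section ClassC.
Variables (F : fieldType) (R : realType) (T : estimated F R).
Hypothesis hT : classC T.

(** Rotation has order 3, so one implication suffices; it holds because equivalence and exchange of
    roles preserve nonzero forms. *)
Lemma supp_rot s : (srot s \in supp T) = (s \in supp T).
Proof.
suff h u : u \in supp T -> srot u \in supp T.
  by apply/idP/idP => [/h/h|/h //]; rewrite srot3.
case: u => -[i j] k us; case: hT => /(_ _ _ _ us)[[r e] _] _.
by apply/supp_nonzero/(nonzero_tequiv e)/nonzero_trot/supp_nonzero.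
Qed.

Lemma est_rot rho s : 2 <= rho <= 3 -> s \in supp T ->
  est T rho (srot s) = est T rho s.
Proof. by case: s => -[i j] k h us; case: hT => /(_ _ _ _ us)[_ ->]. Qed.

Lemma supp0E s : (s \in supp0 T) =
  (s \in supp T) && [|| s.1.1 == 0, s.1.2 == 0 | s.2 == 0].
Proof. by case: hT => _ ->; rewrite !inE. Qed.

Lemma supp0_rot s : (srot s \in supp0 T) = (s \in supp0 T).
Proof. by rewrite !supp0E supp_rot /= orbA orbC. Qed.

Lemma supp0_supp s : s \in supp0 T -> s \in supp T.
Proof. by rewrite supp0E => /andP[]. Qed.

Lemma suppstarE s : (s \in suppstar T) = (s \in supp T) && (s \notin supp0 T).
Proof. by rewrite !inE; case: (s \in supp T). Qed.

Definition indices : {fset int} := [fset s.1.1 | s in supp T]%fset.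

Lemma mem_indices s : s \in supp T ->
  [/\ s.1.1 \in indices, s.1.2 \in indices & s.2 \in indices].
Proof.
move=> us; split; apply/imfsetP; first by exists s.
  by exists (srot s); rewrite //= supp_rot.
by exists (srot (srot s)); rewrite //= !supp_rot.
Qed.

Lemma supp_tpow N s t : s \in supp (tpow T 'I_N) ->
  (s.1.1 t, s.1.2 t, s.2 t) \in supp T.
Proof.
move=> /suppP[x [y [z [c ->]]]] /=; apply/suppP; exists (x t), (y t), (z t).
by rewrite !ffunE; split=> //; move: c => /prodf_neq0; exact.
Qed.

(** The squared volume is the product of the three part sizes, so the exponent [rho / 3] of the
    volume becomes [rho / 6] on each size. *)
Lemma ln_est_supp0 rho s : 2 <= rho <= 3 -> s \in supp0 T ->
  ln (est T rho s) = rho / 6 * (ln (xsize T s.1.1)%:R + ln (ysize T s.1.2)%:R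
    + ln (zsize T s.2)%:R).
Proof.
move=> h us; rewrite est_mm// ln_powR.
have [x0 y0 z0] := size_gt0 (supp0_supp us).
have := sqr_vol_constituent us.
move/(congr1 (fun n => n%:R : R)); rewrite natrX !natrM => e.
have v0 : 0 < (vol (constituent T s))%:R :> R.
  rewrite lt_neqAle eq_sym ler0n andbT; apply/negP => /eqP v0; move: e.
  by rewrite v0 expr0n/= => /esym/eqP; rewrite !mulf_eq0 !pnatr_eq0 !gtn_eqF.
have : ln ((vol (constituent T s))%:R ^+ 2) = ln ((xsize T s.1.1)%:R
    * (ysize T s.1.2)%:R * (zsize T s.2)%:R) :> R.
  by rewrite e.
rewrite lnXn// !lnM ?posrE ?mulr_gt0 ?ltr0n// => <-.
by rewrite -mulr_natr; field.
Qed.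

End ClassC.

(** * Bound from the variables of one side *)

Section SideBound.
Variables (R : realType) (N : nat) (W : finType) (X : W -> {ffun 'I_N -> int}).
Variables (S : {fset {ffun 'I_N -> int}}) (D : {fset int}).
Variables (pm pt : int -> R) (sx : int -> nat) (z fr : pred 'I_N).
Variables (forced : 'I_N -> int).

(* [pm] weights all positions and [pt] only the free ones [fr]; at the other
   positions the index does not vary. *)
Lemma side_bound (rho : R) : 2 <= rho -> (0 < #|W|)%N ->
  (forall w, X w \in S) -> (forall A, A \in S -> forall t, A t \in D) ->
  (forall i, 0 <= pm i) -> (forall i, 0 <= pt i) -> \sum_(i <- D) pt i <= 1 ->
  (forall w t, 0 < pm (X w t)) -> (forall w t, fr t -> 0 < pt (X w t)) ->
  (forall w t, ~~ fr t -> X w t = forced t) ->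
  (forall w t, (0 < sx (X w t))%N) ->
  (forall A, (#|[set w | X w == A]%SET| <= \prod_(t | z t) sx (A t))%N) ->
  \sum_w \sum_t (ln (pm (X w t)) / 3
     + (rho - 2) / 6 * (if fr t then ln (pt (X w t)) else 0)
     - rho / 6 * (if z t then ln (sx (X w t))%:R else 0))
  <= #|W|%:R * (ln (\sum_(A <- S) \prod_t pm (A t)) / 3 - rho / 6 * ln #|W|%:R).
Proof.
move=> rho2 W0 XS SD pm0 pt0 pt1 pmX ptX Xforced sx0 szX.
pose sz (A : {ffun 'I_N -> int}) : R := (\prod_(t | z t) sx (A t))%:R.
have sz0 w : 0 < sz (X w) by rewrite ltr0n prodn_cond_gt0.
have szX' w : #|[set y | X y == X w]%SET|%:R <= sz (X w) by rewrite ler_nat.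
have lnsz w : ln (sz (X w)) = \sum_t (if z t then ln (sx (X w t))%:R else 0) :> R.
  by rewrite /sz natr_prod ln_prod -?big_mkcond// => t _; rewrite ltr0n.
have fiber q : (forall t i, 0 <= q t i) -> (forall w t, 0 < q t (X w t)) ->
    \sum_w (ln (\prod_t q t (X w t)) - ln (sz (X w)))
    <= #|W|%:R * (ln (\sum_(A <- S) \prod_t q t (A t)) - ln (#|W|%:R)).
  move=> q0 qX.
  apply: (@sum_ln_fiber_le R W _ X S (fun A => \prod_t q t (A t)) sz) => //.
    by move=> A _; apply: prodr_ge0.
  by move=> w; apply: prodr_gt0.
have h1 := fiber (fun=> pm) (fun=> pm0) pmX.
(* The second weight is [pt] at the free positions and the point mass at [forced t] elsewhere; point
   masses contribute no logarithm. *)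
pose q t i : R := if fr t then pt i else (i == forced t)%:R.
have q0 t i : 0 <= q t i by rewrite /q; case: ifP => // _; rewrite ler0n.
have qX w t : 0 < q t (X w t).
  rewrite /q; case: ifPn => [/ptX//|/Xforced ->]; by rewrite eqxx ltr01.
have h2 := fiber q q0 qX.
have q1 t : \sum_(i <- D) q t i <= 1.
  rewrite /q; case: (fr t) => //.
  rewrite (eq_bigr (fun i => if i == forced t then 1 else 0)); last first.
    by move=> i _; case: eqP.
  rewrite -big_mkcond /= -big_filter.
  have [iD|iD] := boolP (forced t \in D).
    by rewrite filter_pred1_uniq ?fset_uniq// big_seq1.
  rewrite big_filter big_seq_cond big1// => i /andP[iD' /eqP ei].
  by move: iD; rewrite -ei iD'.
have l2 := ln_le0 (sum_prod_le1 q0 q1 SD).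
have e1 : \sum_w \sum_t ln (pm (X w t)) - \sum_w ln (sz (X w)) <=
    #|W|%:R * (ln (\sum_(A <- S) \prod_t pm (A t)) - ln #|W|%:R).
  rewrite -sumrB; apply: le_trans h1; apply: ler_sum => w _.
  by rewrite ln_prod.
have e2 : \sum_w \sum_t (if fr t then ln (pt (X w t)) else 0) - \sum_w ln (sz (X w)) <=
    #|W|%:R * (- ln #|W|%:R).
  rewrite -sumrB;
      apply: (@le_trans _ _ (\sum_x (ln (\prod_t q t (X x t)) - ln (sz (X x))))).
    apply: ler_sum => w _; rewrite ln_prod// lerD2r ler_sum// => t _.
    by rewrite /q; case: ifPn => // /Xforced ->; rewrite eqxx ln1.
  apply: (le_trans h2); rewrite ler_wpM2l ?ler0n//; lra.
(* The two estimates are combined with coefficients [1 / 3] and [(rho - 2) / 6], which add up to the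
   [rho / 6] of the size terms and of [ln #|W|]. *)
have -> : \sum_w \sum_t (ln (pm (X w t)) / 3
     + (rho - 2) / 6 * (if fr t then ln (pt (X w t)) else 0)
     - rho / 6 * (if z t then ln (sx (X w t))%:R else 0))
  = (\sum_w \sum_t ln (pm (X w t)) - \sum_w ln (sz (X w))) / 3 +
    (rho - 2) / 6 * (\sum_w \sum_t (if fr t then ln (pt (X w t)) else 0)
        - \sum_w ln (sz (X w))).
  rewrite -!sumrB mulr_suml mulr_sumr -big_split; apply: eq_bigr => w _ /=.
  by rewrite lnsz !sumrB !big_split/= -!mulr_suml -!mulr_sumr; field.
have t0 : 0 <= (rho - 2) / 6 by lra.
have t1 : 0 <= 3^-1 :> R by lra.
apply: le_trans (lerD (ler_wpM2r t1 e1) (ler_wpM2l t0 e2)) _.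
by rewrite le_eqVlt; apply/orP; left; apply/eqP; field.
Qed.

End SideBound.

(** * The value of one class *)

Section ClassBound.
Variables (F : fieldType) (R : realType) (T : estimated F R) (N : nat).

(** The conclusion of [mm_class] as data, so that dimensions can be chosen for all classes at once
    and used to form types. *)
Record mmclass (pi : pattern N) (E : {fset annot N}) := MMClass {
  cn : nat; cm : nat; cp : nat;
  cX : 'I_cn * 'I_cm -> {ffun 'I_N -> int};
  cY : 'I_cm * 'I_cp -> {ffun 'I_N -> int};
  cZ : 'I_cp * 'I_cn -> {ffun 'I_N -> int};
  c_vol : vol (zero_sum T pi E) = (cn * cm * cp)%N;
  c_mem : forall i j k, (cX (i, j), cY (j, k), cZ (k, i)) \in E;
  c_sizeX : forall A, (#|[set w | cX w == A]%SET|
     <= \prod_(t | pi t == None) xsize T (A t))%N;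
  c_sizeY : forall A, (#|[set w | cY w == A]%SET|
     <= \prod_(t | pi t == None) ysize T (A t))%N;
  c_sizeZ : forall A, (#|[set w | cZ w == A]%SET|
     <= \prod_(t | pi t == None) zsize T (A t))%N }.

Lemma consistent_mmclass pi E : consistent T pi E -> mmclass pi E.
Proof.
move=> /mm_class h; suff : exists _ : mmclass pi E, True by move=> /cid[].
have [n [m [p [X [Y [Z [hv he [hX hY hZ]]]]]]]] := h.
by exists (MMClass hv he hX hY hZ).
Qed.

Section Terms.
Variables (pi : pattern N) (E : {fset annot N}) (d : mmclass pi E).

Definition term := ('I_(cn d) * 'I_(cm d) * 'I_(cp d))%type.

Definition term_annot (w : term) : annot N :=
  (cX (w.1.1, w.1.2), cY (w.1.2, w.2), cZ (w.2, w.1.1)).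

Definition term_at (w : term) (t : 'I_N) : int * int * int :=
  ((term_annot w).1.1 t, (term_annot w).1.2 t, (term_annot w).2 t).

(** Each x-variable occurs in [cp d] terms, one for each value of the index it does not involve, so
    a uniform term yields a uniform x-variable. *)
Lemma sum_term_xy (f : 'I_(cn d) * 'I_(cm d) -> R) :
  \sum_(w : term) f (w.1.1, w.1.2) = (cp d)%:R * \sum_v f v.
Proof.
rewrite -(pair_bigA _ (fun v (_ : 'I_(cp d)) => f (v.1, v.2)))/= mulr_sumr.
by apply: eq_bigr => -[i j] _; rewrite sumr_const card_ord mulr_natl.
Qed.

Lemma sum_term_yz (f : 'I_(cm d) * 'I_(cp d) -> R) :
  \sum_(w : term) f (w.1.2, w.2) = (cn d)%:R * \sum_v f v.
Proof.
rewrite -(pair_bigA _ (fun v (k : 'I_(cp d)) => f (v.2, k)))/=.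
rewrite -(pair_bigA _ (fun (i : 'I_(cn d)) j => \sum_(k < cp d) f (j, k)))/=.
rewrite sumr_const card_ord mulr_natl pair_bigA/=; congr (_ *+ _).
by apply: eq_bigr => -[].
Qed.

Lemma sum_term_zx (f : 'I_(cp d) * 'I_(cn d) -> R) :
  \sum_(w : term) f (w.2, w.1.1) = (cm d)%:R * \sum_v f v.
Proof.
rewrite -(pair_bigA _ (fun v (k : 'I_(cp d)) => f (k, v.1)))/=.
rewrite -(pair_bigA _
    (fun (i : 'I_(cn d)) (j : 'I_(cm d)) => \sum_(k < cp d) f (k, i)))/=.
under eq_bigr do rewrite sumr_const card_ord -mulr_natl.
rewrite -mulr_sumr exchange_big pair_bigA/=; congr (_ * _).
by apply: eq_bigr => -[].
Qed.

Definition xindices : {fset {ffun 'I_N -> int}} := [fset s.1.1 | s in E]%fset.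
Definition yindices : {fset {ffun 'I_N -> int}} := [fset s.1.2 | s in E]%fset.
Definition zindices : {fset {ffun 'I_N -> int}} := [fset s.2 | s in E]%fset.

End Terms.

Definition seq_weight (f : int -> R) (S : {fset {ffun 'I_N -> int}}) : R :=
  \sum_(A <- S) \prod_t f (A t).

Hypothesis hT : classC T.
Variable rho : R.
Hypothesis hrho : 2 <= rho <= 3.

(** Contribution of one position to the bound for a class. At a zero position coherence forces one
    index to be 0, and that side carries no [pt] weight; subtracting [ln (pt 0)] removes it without
    naming the side. *)
Definition gain (pm pt : int -> R) (s : int * int * int) : R :=
  ln (est T rho s) - (ln (pm s.1.1) + ln (pm s.1.2) + ln (pm s.2)) / 3
  - (rho - 2) / 6 * (if s \in supp0 T
      then ln (pt s.1.1) + ln (pt s.1.2) + ln (pt s.2) - ln (pt 0) else 0).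

(** [side_bound] is applied to each side and multiplied by the number of terms containing a given
    variable. Since ln(nm) + ln(mp) + ln(pn) = 2 ln(nmp), the three coefficients [rho / 6] yield the
    exponent [rho / 3] of the volume. *)
Lemma class_bound pi E (d : mmclass pi E) (pm pt : int -> R) :
  consistent T pi E -> coherent pi E ->
  (0 < cn d)%N -> (0 < cm d)%N -> (0 < cp d)%N ->
  (forall t u, pi t = Some u -> 0 < est T rho u) ->
  (forall i, 0 <= pm i) -> (forall i, 0 <= pt i) ->
  \sum_(i <- indices T) pt i <= 1 ->
  (forall (w : term d) t, [/\ 0 < pm (term_at w t).1.1, 0 < pm (term_at w t).1.2
     & 0 < pm (term_at w t).2]) ->
  (forall (w : term d) t, pi t = None -> let s := term_at w t in
     [/\ s.1.1 = 0 -> 0 < pt s.1.2 /\ 0 < pt s.2,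
         s.1.2 = 0 -> 0 < pt s.1.1 /\ 0 < pt s.2
       & s.2 = 0 -> 0 < pt s.1.1 /\ 0 < pt s.1.2]) ->
  (cn d * cm d * cp d)%:R * ln (sum_val T rho pi E)
  <= \sum_(w : term d) \sum_t gain pm pt (term_at w t)
     + (cn d * cm d * cp d)%:R / 3 * (ln (seq_weight pm (xindices E))
        + ln (seq_weight pm (yindices E)) + ln (seq_weight pm (zindices E))).
Proof.
move=> [Esupp patt conf _] [PX [PY [PZ [PU [dXY dYZ dXZ] coh]]]] n0 m0 p0 est0
  pm0 pt0 pt1 pmw ptw.
have rho2 : 2 <= rho by case/andP: hrho.
have annE (w : term d) : term_annot w \in E by exact: c_mem.
have ats (w : term d) t : term_at w t \in supp T.
  by apply: (@supp_tpow _ _ _ N (term_annot w)); exact: (fsubsetP Esupp).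
have conft (w : term d) t := conf _ (annE w) t.
pose i0 := Ordinal n0; pose j0 := Ordinal m0; pose k0 := Ordinal p0.
have zP t : (pi t == None) = [|| t \in PX, t \in PY | t \in PZ].
  by have /setP/(_ t) := PU; rewrite !inE orbA => ->.
have memI s t : s \in E -> [/\ s.1.1 t \in indices T, s.1.2 t \in indices T
    & s.2 t \in indices T].
  by move=> sE; have /(mem_indices hT) := supp_tpow t (fsubsetP Esupp _ sE).
(* The index at a position not free on a side: imposed by the pattern, or 0 by coherence. *)
pose force (side : int * int * int -> int) t := if pi t is Some u then side u else 0.
have hX : \sum_(v : 'I_(cn d) * 'I_(cm d)) \sum_t (ln (pm (cX v t)) / 3
     + (rho - 2) / 6 * (if (pi t == None) && (t \notin PX) then ln (pt (cX v t)) else 0)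
     - rho / 6 * (if pi t == None then ln (xsize T (cX v t))%:R else 0))
   <= (cn d * cm d)%:R * (ln (seq_weight pm (xindices E)) / 3
        - rho / 6 * ln (cn d * cm d)%:R).
  have <- : #|{: 'I_(cn d) * 'I_(cm d)}| = (cn d * cm d)%N.
    by rewrite card_prod !card_ord.
  apply: (@side_bound R N _ _ (xindices E) (indices T) pm pt (xsize T)
    (fun t => pi t == None) (fun t => (pi t == None) && (t \notin PX))
    (force (fun u => u.1.1))) => //.
  - by rewrite card_prod !card_ord muln_gt0 n0.
  - move=> [i j]; apply/imfsetP; exists (term_annot ((i, j, k0) : term d)) => //=.
  - by move=> A /imfsetP[s /= sE ->] t; have [] := memI s t sE.
  - by move=> [i j] t; have [] := pmw (i, j, k0) t.
  (* A position free for x lies in [PY] or [PZ], so another index is 0 there and the hypothesis on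
     [pt] applies. *)
  - move=> [i j] t /andP[/eqP pN]; have /= [hx hy hz] := ptw (i, j, k0) t pN.
    move/eqP: (pN); rewrite zP => /orP[-> //|/orP[tP _|tP _]].
      by have [_ /(_ t tP)/hy[]] := coh _ (annE (i, j, k0)).
    by have [_ _ /(_ t tP)/hz[]] := coh _ (annE (i, j, k0)).
  - move=> [i j] t; rewrite negb_and negbK /force; have := conft (i, j, k0) t.
    case: (pi t) => [u <- //|_ /= tP].
    by have [/(_ t tP)] := coh _ (annE (i, j, k0)).
  - by move=> [i j] t; have [] := size_gt0 (ats (i, j, k0) t).
  - exact: c_sizeX.
have hY : \sum_(v : 'I_(cm d) * 'I_(cp d)) \sum_t (ln (pm (cY v t)) / 3
     + (rho - 2) / 6 * (if (pi t == None) && (t \notin PY) then ln (pt (cY v t)) else 0)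
     - rho / 6 * (if pi t == None then ln (ysize T (cY v t))%:R else 0))
   <= (cm d * cp d)%:R * (ln (seq_weight pm (yindices E)) / 3
        - rho / 6 * ln (cm d * cp d)%:R).
  have <- : #|{: 'I_(cm d) * 'I_(cp d)}| = (cm d * cp d)%N.
    by rewrite card_prod !card_ord.
  apply: (@side_bound R N _ _ (yindices E) (indices T) pm pt (ysize T)
    (fun t => pi t == None) (fun t => (pi t == None) && (t \notin PY))
    (force (fun u => u.1.2))) => //.
  - by rewrite card_prod !card_ord muln_gt0 m0.
  - move=> [j k]; apply/imfsetP; exists (term_annot ((i0, j, k) : term d)) => //=.
  - by move=> A /imfsetP[s /= sE ->] t; have [] := memI s t sE.
  - by move=> [j k] t; have [] := pmw (i0, j, k) t.
  - move=> [j k] t /andP[/eqP pN]; have /= [hx hy hz] := ptw (i0, j, k) t pN.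
    move/eqP: (pN); rewrite zP => /orP[tP _|/orP[-> //|tP _]].
      by have [/(_ t tP)/hx[]] := coh _ (annE (i0, j, k)).
    by have [_ _ /(_ t tP)/hz[]] := coh _ (annE (i0, j, k)).
  - move=> [j k] t; rewrite negb_and negbK /force; have := conft (i0, j, k) t.
    case: (pi t) => [u <- //|_ /= tP].
    by have [_ /(_ t tP)] := coh _ (annE (i0, j, k)).
  - by move=> [j k] t; have [] := size_gt0 (ats (i0, j, k) t).
  - exact: c_sizeY.
have hZ : \sum_(v : 'I_(cp d) * 'I_(cn d)) \sum_t (ln (pm (cZ v t)) / 3
     + (rho - 2) / 6 * (if (pi t == None) && (t \notin PZ) then ln (pt (cZ v t)) else 0)
     - rho / 6 * (if pi t == None then ln (zsize T (cZ v t))%:R else 0))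
   <= (cp d * cn d)%:R * (ln (seq_weight pm (zindices E)) / 3
        - rho / 6 * ln (cp d * cn d)%:R).
  have <- : #|{: 'I_(cp d) * 'I_(cn d)}| = (cp d * cn d)%N.
    by rewrite card_prod !card_ord.
  apply: (@side_bound R N _ _ (zindices E) (indices T) pm pt (zsize T)
    (fun t => pi t == None) (fun t => (pi t == None) && (t \notin PZ))
    (force (fun u => u.2))) => //.
  - by rewrite card_prod !card_ord muln_gt0 p0.
  - move=> [k i]; apply/imfsetP; exists (term_annot ((i, j0, k) : term d)) => //=.
  - by move=> A /imfsetP[s /= sE ->] t; have [] := memI s t sE.
  - by move=> [k i] t; have [] := pmw (i, j0, k) t.
  - move=> [k i] t /andP[/eqP pN]; have /= [hx hy hz] := ptw (i, j0, k) t pN.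
    move/eqP: (pN); rewrite zP => /orP[tP _|/orP[tP _|-> //]].
      by have [/(_ t tP)/hx[]] := coh _ (annE (i, j0, k)).
    by have [_ /(_ t tP)/hy[]] := coh _ (annE (i, j0, k)).
  - move=> [k i] t; rewrite negb_and negbK /force; have := conft (i, j0, k) t.
    case: (pi t) => [u <- //|_ /= tP].
    by have [_ _ /(_ t tP)] := coh _ (annE (i, j0, k)).
  - by move=> [k i] t; have [] := size_gt0 (ats (i, j0, k) t).
  - exact: c_sizeZ.
(* At a zero position the logarithm of the estimate splits into those of the part sizes, which
   cancel the size terms of the three sides; elsewhere only the estimate and [pm] remain. *)
have gainE (w : term d) t : gain pm pt (term_at w t)
  = (if pi t is Some u then ln (est T rho u) else 0)
    - (ln (pm (cX (w.1.1, w.1.2) t)) / 3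
     + (rho - 2) / 6
         * (if (pi t == None) && (t \notin PX) then ln (pt (cX (w.1.1, w.1.2) t))
         else 0)
     - rho / 6 * (if pi t == None then ln (xsize T (cX (w.1.1, w.1.2) t))%:R else 0))
    - (ln (pm (cY (w.1.2, w.2) t)) / 3
     + (rho - 2) / 6
         * (if (pi t == None) && (t \notin PY) then ln (pt (cY (w.1.2, w.2) t)) else 0)
     - rho / 6 * (if pi t == None then ln (ysize T (cY (w.1.2, w.2) t))%:R else 0))
    - (ln (pm (cZ (w.2, w.1.1) t)) / 3
     + (rho - 2) / 6
         * (if (pi t == None) && (t \notin PZ) then ln (pt (cZ (w.2, w.1.1) t)) else 0)
     - rho / 6 * (if pi t == None then ln (zsize T (cZ (w.2, w.1.1) t))%:R else 0)).
  rewrite /gain; have := conft w t; have := ptw w t; have := zP t.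
  have [cx cy cz] := coh _ (annE w).
  case ep: (pi t) => [u|] /=.
    move=> _ _ cu; have us := patt _ _ ep.
    have u0 : u \notin supp0 T by move: us; rewrite suppstarE => /andP[].
    rewrite -/(term_at w t) in cu; rewrite cu (negbTE u0) -cu /=; ring.
  move=> tP _; rewrite -/(term_at w t) => w0.
  rewrite w0 (ln_est_supp0 hT hrho w0) /=.
  have [tX|tX] := boolP (t \in PX).
    have -> : (t \in PY) = false by exact: (disjointFr dXY).
    have -> : (t \in PZ) = false by exact: (disjointFr dXZ).
    by have /= -> := cx _ tX; ring.
  have [tY|tY] := boolP (t \in PY).
    have -> : (t \in PZ) = false by exact: (disjointFr dYZ).
    by have /= -> := cy _ tY; ring.
  move: tP; rewrite (negbTE tX) (negbTE tY) /= => /esym tZ.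
  by rewrite tZ /=; have /= -> := cz _ tZ; ring.
have -> : \sum_(w : term d) \sum_t gain pm pt (term_at w t) =
  (cn d * cm d * cp d)%:R * \sum_t (if pi t is Some u then ln (est T rho u) else 0)
  - (cp d)%:R * \sum_(v : 'I_(cn d) * 'I_(cm d)) \sum_t (ln (pm (cX v t)) / 3
     + (rho - 2) / 6 * (if (pi t == None) && (t \notin PX) then ln (pt (cX v t)) else 0)
     - rho / 6 * (if pi t == None then ln (xsize T (cX v t))%:R else 0))
  - (cn d)%:R * \sum_(v : 'I_(cm d) * 'I_(cp d)) \sum_t (ln (pm (cY v t)) / 3
     + (rho - 2) / 6 * (if (pi t == None) && (t \notin PY) then ln (pt (cY v t)) else 0)
     - rho / 6 * (if pi t == None then ln (ysize T (cY v t))%:R else 0))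
  - (cm d)%:R * \sum_(v : 'I_(cp d) * 'I_(cn d)) \sum_t (ln (pm (cZ v t)) / 3
     + (rho - 2) / 6 * (if (pi t == None) && (t \notin PZ) then ln (pt (cZ v t)) else 0)
     - rho / 6 * (if pi t == None then ln (zsize T (cZ v t))%:R else 0)).
  rewrite -sum_term_xy -sum_term_yz -sum_term_zx.
  have -> : (cn d * cm d * cp d)%:R *
      \sum_t (if pi t is Some u then ln (est T rho u) else 0)
     =  \sum_(w : term d) \sum_t (if pi t is Some u then ln (est T rho u) else 0).
    by rewrite sumr_const !card_prod !card_ord mulr_natl.
  rewrite -!sumrB; apply: eq_bigr => w _; rewrite -!sumrB; apply: eq_bigr => t _.
  exact: gainE.
have -> : ln (sum_val T rho pi E) = rho / 3 * ln (cn d * cm d * cp d)%:R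
    + \sum_t (if pi t is Some u then ln (est T rho u) else 0).
  rewrite /sum_val (c_vol d) lnM ?posrE; last 2 first.
  - by rewrite powR_gt0// ltr0n !muln_gt0 n0 m0.
  - by apply: prodr_gt0 => t _; case ep: (pi t) => [u|]//; exact: (est0 _ _ ep).
  rewrite ln_powR ln_prod; last by move=> t _; case ep: (pi t) => [u|]//;
      exact: (est0 _ _ ep).
  by congr (_ + _); apply: eq_bigr => t _; case: (pi t) => [//|]; exact: ln1.
have n0' : 0 < (cn d)%:R :> R by rewrite ltr0n.
have m0' : 0 < (cm d)%:R :> R by rewrite ltr0n.
have p0' : 0 < (cp d)%:R :> R by rewrite ltr0n.
move: (ler_wpM2l (ltW p0') hX) (ler_wpM2l (ltW n0') hY) (ler_wpM2l (ltW m0') hZ).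
rewrite !natrM !lnM ?posrE ?mulr_gt0//.
set SX := \sum_v _; set SY := \sum_v _; set SZ := \sum_v _; set SE := \sum_t _.
set lX := ln (seq_weight _ _); set lY := ln (seq_weight _ _); set lZ := ln (seq_weight _ _).
set ln_n := ln (cn d)%:R; set ln_m := ln _; set ln_p := ln _.
move: (cn d)%:R (cm d)%:R (cp d)%:R => a b c h1 h2 h3.
have {h1 h2 h3} := lerD (lerD h1 h2) h3.
rewrite -subr_ge0 => h; rewrite -subr_ge0; apply: le_trans h _.
by rewrite le_eqVlt; apply/orP; left; apply/eqP; field.
Qed.

End ClassBound.

(** * Symmetric distributions *)

Lemma ln2_gt0 (R : realType) : 0 < ln 2 :> R.
Proof. by rewrite ln_gt0// ltr1n. Qed.

Lemma elog2_gt0 (R : realType) (x : R) : 0 < x -> elog2 x = (ln x / ln 2)%:E.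
Proof. by move=> x0; rewrite /elog2 lne_EFin// EFinM. Qed.

Lemma elog2_le0 (R : realType) (x : R) : x <= 0 -> elog2 x = -oo%E.
Proof.
move=> x0; rewrite /elog2 le0_lneNy ?lee_fin// gt0_mulNye// lte_fin invr_gt0.
exact: ln2_gt0.
Qed.

Lemma entropy_fset (R : realType) (D : {fset int}) (p : int -> R) :
  (forall i, i \notin D -> p i = 0) ->
  entropy p = - (\sum_(i <- D) p i * ln (p i)) / ln 2.
Proof.
move=> pD; rewrite /entropy mulNr; congr (- _).
rewrite -(fsbig_widen [set` D]%classic)//; last first.
  by move=> i /= [_ /negP iD]; rewrite pD ?mul0r.
rewrite -fsbig_seq ?fset_uniq// mulr_suml.
by apply: eq_bigr => i _; rewrite /log2 mulrA.
Qed.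

Section SymmetricDistributions.
Variables (F : fieldType) (R : realType) (T : estimated F R).
Hypothesis hT : classC T.

Lemma sum_supp_rot (f : int * int * int -> R) :
  \sum_(s <- supp T) f (srot s) = \sum_(s <- supp T) f s.
Proof.
rewrite -(big_map srot xpredT f); apply: perm_big; apply: uniq_perm.
- rewrite map_inj_uniq ?fset_uniq//.
  by move=> s u /(congr1 (fun x => srot (srot x))); rewrite !srot3.
- exact: fset_uniq.
move=> s; apply/mapP/idP => [[u us ->]|us]; first by rewrite supp_rot.
by exists (srot (srot s)); rewrite ?srot3 ?supp_rot.
Qed.

Lemma sum_sdist_rot P (f : int * int * int -> R) : sdist T P ->
  \sum_(s <- supp T) P s * f (srot s) = \sum_(s <- supp T) P s * f s.
Proof.
move=> [_ _ _ Pr]; rewrite -[RHS]sum_supp_rot; apply: eq_bigr => -[[i j] k] _.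
by rewrite Pr.
Qed.

Lemma sum_marginal (D : {fset int}) (P : int * int * int -> R) g :
  (indices T `<=` D)%fset ->
  \sum_(i <- D) marginal T P i * g i = \sum_(s <- supp T) P s * g s.1.1.
Proof.
move=> /fsubsetP sub; under eq_bigr do rewrite mulr_suml.
rewrite (exchange_big_dep predT)//= big_seq [RHS]big_seq; apply: eq_bigr => s us.
rewrite -big_filter (eq_filter (a2 := pred1 s.1.1)); last by move=> i;
    rewrite /= eq_sym.
rewrite filter_pred1_uniq ?fset_uniq ?big_seq1//.
by apply: sub; have [] := mem_indices hT us.
Qed.

Lemma marginal_out (P : int * int * int -> R) i : i \notin indices T ->
  marginal T P i = 0.
Proof.
move=> iD; rewrite /marginal big_seq_cond big1// => s /andP[us /eqP si].
by move: iD; rewrite -si; have [->] := mem_indices hT us.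
Qed.

Lemma sum_supp0 (f : int * int * int -> R) :
  \sum_(s <- supp0 T) f s = \sum_(s <- supp T) (if s \in supp0 T then f s else 0).
Proof.
rewrite -big_mkcond/= -[RHS]big_filter; apply: perm_big; apply: uniq_perm;
  rewrite ?filter_uniq ?fset_uniq// => s.
by rewrite mem_filter; case: (boolP (s \in supp0 T)) => // /supp0_supp ->.
Qed.

(* Up to normalization, this is the distribution [dtilde P]. *)
Definition excess (P : int * int * int -> R) (i : int) : R :=
  marginal T P i - marginal T (dstar T P) i - (i == 0)%:R * mass0 T P / 3.

Lemma marginal_dstar0 P : marginal T (dstar T P) 0 = 0 :> R.
Proof.
rewrite /marginal big1// => s /eqP s0; rewrite /dstar; case: ifP => //.
by rewrite suppstarE supp0E// s0 eqxx /= andbT andbN.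
Qed.

Lemma dtildeE P i : dtilde T P i = 3 / (2 * mass0 T P) * excess P i.
Proof.
rewrite /dtilde /excess; case: eqP => [->|_] /=; last by rewrite mul0r mul0r subr0.
by rewrite marginal_dstar0 subr0 mul1r.
Qed.

(** 0 is adjoined so that the correction of [excess] at 0 always lies in the range of summation. *)
Definition indices0 : {fset int} := (0 |` indices T)%fset.

Lemma sub_indices0 : (indices T `<=` indices0)%fset.
Proof. by apply/fsubsetP => i iD; rewrite !inE iD orbT. Qed.

Lemma excess_out P i : i \notin indices0 -> excess P i = 0.
Proof.
rewrite !inE negb_or => /andP[/negbTE i0 iD].
by rewrite /excess !marginal_out// i0 !mul0r !subr0.
Qed.

(** Removing the [dstar] part leaves the annotations in [supp0 T], over which the correction at 0
    spreads as [g 0 / 3] each. *)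
Lemma sum_excess P (g : int -> R) :
  \sum_(i <- indices0) excess P i * g i = \sum_(s <- supp T)
    P s * (if s \in supp0 T then g s.1.1 - g 0 / 3 else 0).
Proof.
under eq_bigr do rewrite /excess !mulrBl.
rewrite !sumrB !(sum_marginal _ _ sub_indices0).
have -> : \sum_(i <- indices0) (i == 0)%:R * mass0 T P / 3 * g i = mass0 T P / 3 * g 0.
  rewrite (bigD1_seq 0)/= ?fset_uniq ?inE// mul1r big1 ?addr0// => i /negbTE ->.
  by rewrite !mul0r.
rewrite /mass0 sum_supp0 !mulr_suml -!sumrB big_seq [RHS]big_seq;
    apply: eq_bigr => s us.
by rewrite /dstar suppstarE us; case: (s \in supp0 T) => /=; ring.
Qed.

(** Coefficient of [P s] in [excess P i] after averaging over rotations: a third of the number of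
    indices equal to [i], with one zero discounted. An annotation in [supp0 T] has a zero index,
    hence nonnegativity. *)
Definition excess_coef (i : int) (s : int * int * int) : R :=
  if s \in supp0 T then
    ((s.1.1 == i)%:R + (s.1.2 == i)%:R + (s.2 == i)%:R - (i == 0)%:R) / 3
  else 0.

Lemma excess_coef_ge0 i s : 0 <= excess_coef i s.
Proof.
rewrite /excess_coef; case: ifP => //; rewrite supp0E// => /andP[_ h].
rewrite divr_ge0//; have [->|] := eqVneq i 0; last by rewrite subr0 !addr_ge0.
by case/or3P: h => ->; rewrite /= ?mulr1n; move: (_ == _) (_ == _) => [] [] /=; lra.
Qed.

Lemma excessE P i : sdist T P ->
  excess P i = \sum_(s <- supp T) P s * excess_coef i s.
Proof.
move=> hP.
pose f u : R := if u \in supp0 T then (u.1.1 == i)%:R - (i == 0)%:R / 3 else 0.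
have -> : excess P i = \sum_(u <- supp T) P u * f u.
  have [iD|iD] := boolP (i \in indices0).
    rewrite /f; have := sum_excess P (fun j => (j == i)%:R).
    rewrite (bigD1_seq i)/= ?fset_uniq// eqxx mulr1 big1 ?addr0 => [->|j /negbTE ->].
      by rewrite [0 == i]eq_sym.
    by rewrite mulr0.
  rewrite excess_out// big_seq big1// => u uT.
  move: iD; rewrite /f !inE negb_or => /andP[/negbTE -> iD].
  have [/eqP ui|_] := boolP (u.1.1 == i); last by case: ifP;
      rewrite ?subr0 ?mul0r ?subr0 ?mulr0.
  by move: iD; rewrite -ui; have [->] := mem_indices hT uT.
(* By symmetry of [P], [f] may be replaced by its average over the rotations. *)
have h1 := sum_sdist_rot f hP; have h2 := sum_sdist_rot (fun u => f (srot u)) hP.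
have -> : \sum_(u <- supp T) P u * f u
    = \sum_(u <- supp T) P u * ((f u + f (srot u) + f (srot (srot u))) / 3).
  under [RHS]eq_bigr do rewrite mulrA !mulrDr.
  by rewrite -mulr_suml !big_split/= h2 h1; field.
apply: eq_bigr => u _; congr (_ * _).
by rewrite /f /excess_coef !supp0_rot//; case: ifP => _ /=; field.
Qed.

Lemma excess_ge0 P i : sdist T P -> 0 <= excess P i.
Proof.
move=> hP; rewrite excessE//; have [P0 _ _ _] := hP; apply: sumr_ge0 => s _.
by rewrite mulr_ge0// excess_coef_ge0.
Qed.

Lemma mass0_ge0 P : sdist T P -> 0 <= mass0 T P.
Proof. by move=> [P0 _ _ _]; apply: sumr_ge0. Qed.

Lemma dtilde_ge0 P i : sdist T P -> 0 <= dtilde T P i.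
Proof.
by move=> hP; rewrite dtildeE mulr_ge0 ?excess_ge0// divr_ge0// mulr_ge0// mass0_ge0.
Qed.

(** Only one zero is discounted, and the first index provides it, so the other two keep a positive
    coefficient even if they are 0 too. This is the positivity of [pt] that [class_bound]
    requires. *)
Lemma dtilde_gt0 P s : sdist T P -> s \in supp0 T -> 0 < P s -> s.1.1 = 0 ->
  0 < dtilde T P s.1.2 /\ 0 < dtilde T P s.2.
Proof.
move=> hP s0 Ps s110; have [P0 _ _ _] := hP.
have sT := supp0_supp hT s0.
have m0 : 0 < mass0 T P.
  rewrite /mass0 (bigD1_seq s)/= ?fset_uniq// ltr_pwDl// big_seq_cond.
  by apply: sumr_ge0.
have pos i : 0 < excess_coef i s -> 0 < dtilde T P i.
  move=> ci; rewrite dtildeE mulr_gt0 ?divr_gt0 ?mulr_gt0// excessE//.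
  rewrite (bigD1_seq s)/= ?fset_uniq// ltr_pwDl ?mulr_gt0//.
  by apply: sumr_ge0 => u _; rewrite mulr_ge0// excess_coef_ge0.
by split; apply: pos; rewrite /excess_coef s0 s110 eqxx divr_gt0// [0 == _]eq_sym;
  move: (_ == _) (_ == _) => [] [] /=; lra.
Qed.

(** Every annotation in [supp0 T] contributes [1 - 1 / 3], which explains the normalization of
    [dtilde]. *)
Lemma sum_excess1 P : \sum_(i <- indices0) excess P i = 2 / 3 * mass0 T P.
Proof.
under eq_bigr do rewrite -[excess P _]mulr1.
rewrite (sum_excess P (fun=> 1)) /mass0 sum_supp0 mulr_sumr; apply: eq_bigr => s _.
by case: ifP => _; [field|rewrite !mulr0].
Qed.

Lemma sum_dtilde_le1 P : sdist T P -> \sum_(i <- indices T) dtilde T P i <= 1.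
Proof.
move=> hP; apply: (@le_trans _ _ (\sum_(i <- indices0) dtilde T P i)).
  rewrite /indices0; have [i0|i0] := boolP (0 \in indices T).
    by rewrite mem_fset1U.
  by rewrite big_fsetU1//= lerDr dtilde_ge0.
under eq_bigr do rewrite dtildeE.
rewrite -mulr_sumr sum_excess1.
have [->|m0] := eqVneq (mass0 T P) 0; first by rewrite !mulr0.
by rewrite le_eqVlt; apply/orP; left; apply/eqP; field.
Qed.

Lemma mass0_entropy_dtilde P :
  mass0 T P * entropy (dtilde T P) = - (3 / 2) * (\sum_(s <- supp T)
    P s * (if s \in supp0 T then ln (dtilde T P s.1.1) - ln (dtilde T P 0) / 3 else 0))
  / ln 2.
Proof.
rewrite (@entropy_fset _ indices0); last first.
  by move=> i iD; rewrite dtildeE excess_out// mulr0.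
rewrite -(sum_excess P (fun i => ln (dtilde T P i))).
(* For mass 0, division by zero makes [dtilde] vanish identically, and [ln 0 = 0]. *)
have [m0|m0] := eqVneq (mass0 T P) 0.
  rewrite m0 mul0r big1 ?mulr0 ?mul0r// => i _.
  by rewrite dtildeE m0 mulr0 invr0 mulr0 mul0r ln0// mulr0.
rewrite mulrA; congr (_ / _); rewrite mulrN mulNr; congr (- _).
rewrite !mulr_sumr; apply: eq_bigr => i _.
by rewrite [in X in X * ln _]dtildeE; field.
Qed.

(** Its average under [P] is the objective times [ln 2], when the estimates charged by [P] are
    positive; its average over rotations is the [gain] of a position. *)
Definition potential rho P (s : int * int * int) : R :=
  ln (est T rho s) - ln (marginal T P s.1.1) - (rho - 2) / 2 *
    (if s \in supp0 T then ln (dtilde T P s.1.1) - ln (dtilde T P 0) / 3 else 0).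

Lemma objectiveE rho P : sdist T P ->
  (forall s, s \in supp T -> 0 < P s -> 0 < est T rho s) ->
  objective T rho P = ((\sum_(s <- supp T) P s * potential rho P s) / ln 2)%:E.
Proof.
move=> [P0 _ _ _] hest; rewrite /objective.
have -> : (\sum_(s <- supp T) (P s)%:E * elog2 (est T rho s))%E
    = (\sum_(s <- supp T) P s * ln (est T rho s) / ln 2)%:E.
  rewrite -sumEFin big_seq [RHS]big_seq; apply: eq_bigr => s sT.
  have [->|Ps] := eqVneq (P s) 0; first by rewrite mul0e !mul0r.
  by rewrite elog2_gt0 ?hest// ?lt_neqAle 1?eq_sym ?Ps ?P0// -EFinM mulrA.
rewrite -!EFinD; congr (_%:E).
rewrite mass0_entropy_dtilde (@entropy_fset _ (indices T)); last exact: marginal_out.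
rewrite (sum_marginal _ _ (fsubset_refl _)) -!mulr_suml.
have -> : \sum_(s <- supp T) P s * potential rho P s =
   \sum_(s <- supp T) P s * ln (est T rho s)
   - \sum_(s <- supp T) P s * ln (marginal T P s.1.1)
   - (rho - 2) / 2 * \sum_(s <- supp T) P s *
      (if s \in supp0 T then ln (dtilde T P s.1.1) - ln (dtilde T P 0) / 3 else 0).
  rewrite mulr_sumr -!sumrB; apply: eq_bigr => s _;
      rewrite /potential; move: (if _ then _ else _) => x; ring.
by field; rewrite gt_eqF// ln2_gt0.
Qed.

End SymmetricDistributions.

(** * Total value of a coherent restriction *)

Section Law.
Variables (F : fieldType) (R : realType) (T : estimated F R).
Hypothesis hT : classC T.
Variables (G : finType) (u : G -> R) (sg : G -> int * int * int).
Hypothesis u0 : forall g, 0 <= u g.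
Hypothesis u1 : \sum_g u g = 1.
Hypothesis sgT : forall g, sg g \in supp T.

(** Averaging over rotations makes the law of [sg g] symmetric, hence a member of [sdist T]. *)
Definition law (s : int * int * int) : R :=
  \sum_g u g * (((sg g == s)%:R + (srot (sg g) == s)%:R
    + (srot (srot (sg g)) == s)%:R) / 3).

Lemma sum_law f : \sum_(s <- supp T) law s * f s
  = \sum_g u g * ((f (sg g) + f (srot (sg g)) + f (srot (srot (sg g)))) / 3).
Proof.
under eq_bigr do rewrite mulr_suml.
rewrite exchange_big/=; apply: eq_bigr => g _.
have pick a : a \in supp T -> \sum_(s <- supp T) (a == s)%:R * f s = f a.
  move=> aT; rewrite (bigD1_seq a)/= ?fset_uniq// eqxx mul1r big1 ?addr0// => s.
  by rewrite eq_sym => /negbTE ->; rewrite mul0r.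
rewrite -(pick _ (sgT g)) -(pick (srot (sg g))) ?supp_rot//.
rewrite -(pick (srot (srot (sg g)))) ?supp_rot//.
rewrite -!big_split mulr_suml mulr_sumr; apply: eq_bigr => s _ /=; ring.
Qed.

Lemma law_sdist : sdist T law.
Proof.
split.
- by move=> s; apply: sumr_ge0 => g _; rewrite mulr_ge0// divr_ge0// !addr_ge0.
- move=> s sT; rewrite /law big1// => g _.
  have ne a : a \in supp T -> (a == s) = false.
    by move=> aT; apply/negbTE; apply: contraNneq sT => <-.
  by rewrite !ne ?supp_rot// !addr0 mul0r mulr0.
- under eq_bigr do rewrite -[law _]mulr1.
  by rewrite (sum_law (fun=> 1)) -[RHS]u1; apply: eq_bigr => g _; field.
- move=> i j k; apply: eq_bigr => g _; congr (_ * (_ / _)).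
  case: (sg g) => -[a b] c; rewrite /srot /= !xpair_eqE.
  have e x y z : x && y && z = y && z && x by case: x y z => [] [] [].
  by rewrite (e (a == i)) (e (b == i)) (e (c == i)) addrC addrA.
Qed.

Lemma law_gt0P s : 0 < law s -> exists2 g, 0 < u g &
  [\/ sg g = s, srot (sg g) = s | srot (srot (sg g)) = s].
Proof.
move=> ls; apply: contrapT => h; move: ls; rewrite /law big1 ?ltxx// => g _.
have [ug|] := ltP 0 (u g); last first.
  by move=> ug; rewrite (@le_anti _ _ (u g) 0) ?ug ?u0// mul0r.
have ne a : (a = sg g \/ a = srot (sg g) \/ a = srot (srot (sg g))) -> (a == s) = false.
  move=> ha; apply/eqP => e; apply: h; exists g => //.
  by rewrite -e; case: ha => [->|[->|->]]; [constructor 1|constructor 2|constructor 3].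
by rewrite !ne ?addr0 ?mul0r ?mulr0; auto.
Qed.

Lemma law_gt0 g : 0 < u g ->
  [/\ 0 < law (sg g), 0 < law (srot (sg g)) & 0 < law (srot (srot (sg g)))].
Proof.
have pos s : 0 < u g -> [\/ sg g = s, srot (sg g) = s | srot (srot (sg g)) = s]
    -> 0 < law s.
  move=> ug h; rewrite /law (bigD1 g)//= ltr_pwDl//.
    rewrite mulr_gt0// divr_gt0//; case: h => ->; rewrite eqxx /=;
      move: (_ == _) (_ == _) => [] [] /=; lra.
  by apply: sumr_ge0 => h' _; rewrite mulr_ge0// divr_ge0// !addr_ge0.
by move=> ug; split; apply: pos => //; [constructor 1|constructor 2|constructor 3].
Qed.

End Law.

Section DisjointFamilies.
Variables (R : realType) (N m : nat) (S : 'I_m -> {fset {ffun 'I_N -> int}}).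

(** Disjoint families merge into one set of sequences, to which [sum_prod_le1] applies. *)
Lemma sum_seq_weight_le1 (f : int -> R) (D : {fset int}) :
  (forall c d, c != d -> [disjoint S c & S d]%fset) ->
  (forall c A, A \in S c -> forall t, A t \in D) ->
  (forall i, 0 <= f i) -> \sum_(i <- D) f i <= 1 ->
  \sum_c seq_weight f (S c) <= 1.
Proof.
move=> dS SD f0 f1; pose K := [fset c | c in 'I_m]%fset.
have -> : \sum_c seq_weight f (S c) = \sum_(c <- K) seq_weight f (S c).
  by rewrite big_imfset/= ?big_enum//; move=> ? ? _ _ /=.
rewrite /seq_weight.
rewrite -(partition_disjoint_bigfcup _
    (fun A : {ffun 'I_N -> int} => \prod_t f (A t))); last first.
  by move=> i j _ _; exact: dS.
apply: (@sum_prod_le1 R _ _ _ D (fun=> f)) => // A.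
by move=> /bigfcupP[c _ /SD]; exact.
Qed.

End DisjointFamilies.

Section ValueBound.
Variables (F : fieldType) (R : realType) (T : estimated F R).
Hypothesis hT : classC T.
Variable rho : R.
Hypothesis hrho : 2 <= rho <= 3.

Lemma gain_potential P s : s \in supp T ->
  gain T rho (marginal T P) (dtilde T P) s
  = (potential T rho P s + potential T rho P (srot s)
     + potential T rho P (srot (srot s))) / 3.
Proof.
move=> sT; rewrite /gain /potential !supp0_rot// !est_rot ?supp_rot//.
by case: (s \in supp0 T) => /=; field.
Qed.

Lemma marginal_gt0 P s : sdist T P -> s \in supp T -> 0 < P s ->
  0 < marginal T P s.1.1.
Proof.
move=> [P0 _ _ _] sT Ps; rewrite /marginal big_mkcond (bigD1_seq s)/= ?fset_uniq//.
by rewrite eqxx ltr_pwDl//; apply: sumr_ge0 => u _; case: ifP.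
Qed.

Lemma marginal_ge0 P i : sdist T P -> 0 <= marginal T P i.
Proof. by move=> [P0 _ _ _]; apply: sumr_ge0. Qed.

Lemma sum_marginal1 P : sdist T P -> \sum_(i <- indices T) marginal T P i = 1.
Proof.
move=> [_ _ P1 _]; under eq_bigr do rewrite -[marginal _ _ _]mulr1.
rewrite (sum_marginal hT P (fun=> 1) (fsubset_refl _)) -[RHS]P1.
by under eq_bigr do rewrite mulr1.
Qed.

Lemma est_gt0_supp0 s : s \in supp0 T -> 0 < est T rho s.
Proof.
move=> s0; rewrite est_mm// powR_gt0// ltr0n -sqrn_gt0 sqr_vol_constituent//.
by have [x0 y0 z0] := size_gt0 (supp0_supp hT s0); rewrite !muln_gt0 x0 y0.
Qed.

Lemma sum_val_ge0 N (pi : pattern N) (E : {fset annot N}) :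
  is_pattern T pi -> 0 <= sum_val T rho pi E.
Proof.
move=> patt; rewrite mulr_ge0 ?powR_ge0//; apply: prodr_ge0 => t _.
case ep: (pi t) => [u|] //; apply: est_ge0 => //.
by have := patt _ _ ep; rewrite suppstarE => /andP[].
Qed.

Lemma sum_val_gt0P N (pi : pattern N) (E : {fset annot N}) (d : mmclass T pi E) :
  is_pattern T pi -> 0 < sum_val T rho pi E ->
  [/\ (0 < cn d)%N, (0 < cm d)%N, (0 < cp d)%N
    & forall t u, pi t = Some u -> 0 < est T rho u].
Proof.
move=> patt; rewrite /sum_val (c_vol d) => h.
have /= h0 : (cn d * cm d * cp d)%:R `^ (rho / 3) != 0.
  by apply: contraTneq h => ->; rewrite mul0r ltxx.
have : (0 < cn d * cm d * cp d)%N.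
  rewrite lt0n; apply: contraNneq h0 => ->; rewrite powR0//.
  by rewrite gt_eqF// divr_gt0//; case/andP: hrho => ? _; lra.
rewrite !muln_gt0 => /andP[/andP[-> ->] ->]; split=> // t u ep.
rewrite lt_neqAle eq_sym; apply/andP; split.
  apply: contraTneq h => e; rewrite (bigD1 t)//= ep e mul0r mulr0 ltxx//.
by apply: est_ge0 => //; have := patt _ _ ep; rewrite suppstarE => /andP[].
Qed.

(** Classes with a common index sequence would share the variables of that part, which is nonempty
    because the annotation lies in the support. *)
Lemma disjoint_sides N m (E : 'I_m -> {fset annot N}) (pi : 'I_m -> pattern N) :
  coherent_restriction T E pi -> forall c d, c != d ->
  [/\ [disjoint xindices (E c) & xindices (E d)]%fset,
      [disjoint yindices (E c) & yindices (E d)]%fset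
    & [disjoint zindices (E c) & zindices (E d)]%fset].
Proof.
move=> [RX [RY [RZ [_ _ _ dvars hc]]]] c d /dvars[dX dY dZ].
have [[[sub _ _ _] _] _] := (hc c, hc d).
split; apply/fdisjointP => A /imfsetP[/= s sE ->]; apply/negP => /imfsetP[/= s' s'E e];
  have /suppP[x [y [z [_ es]]]] := fsubsetP sub _ sE.
- have := disjointFr dX (_ : x \in _); rewrite !inE => h.
  have /h/negP : has (fun s => s.1.1 == xpart (p := tpow T 'I_N) x) (E c).
    by apply/hasP; exists s => //; rewrite es.
  by apply; apply/hasP; exists s' => //; rewrite -e es.
- have := disjointFr dY (_ : y \in _); rewrite !inE => h.
  have /h/negP : has (fun s => s.1.2 == ypart (p := tpow T 'I_N) y) (E c).
    by apply/hasP; exists s => //; rewrite es.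
  by apply; apply/hasP; exists s' => //; rewrite -e es.
- have := disjointFr dZ (_ : z \in _); rewrite !inE => h.
  have /h/negP : has (fun s => s.2 == zpart (p := tpow T 'I_N) z) (E c).
    by apply/hasP; exists s => //; rewrite es.
  by apply; apply/hasP; exists s' => //; rewrite -e es.
Qed.

Lemma value_bound N m (E : 'I_m -> {fset annot N}) (pi : 'I_m -> pattern N) :
  (0 < N)%N -> coherent_restriction T E pi ->
  0 < \sum_c sum_val T rho (pi c) (E c) ->
  exists2 P, sdist T P
    & ((ln (\sum_c sum_val T rho (pi c) (E c)) / N%:R / ln 2)%:E
       <= objective T rho P)%E.
Proof.
move=> N0 hres; have dsides := disjoint_sides hres.
move: hres => [RX [RY [RZ [_ _ _ _ hc]]]]; set v := \sum_c _ => v0.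
have hpat c : is_pattern T (pi c) by have [[_ ? _ _] _] := hc c.
have hsub c : (E c `<=` supp (tpow T 'I_N))%fset by have [[? _ _ _] _] := hc c.
pose d c := consistent_mmclass (hc c).1.
pose p c := sum_val T rho (pi c) (E c) / v.
pose V c : R := (cn (d c) * cm (d c) * cp (d c))%:R.
have p0 c : 0 <= p c by rewrite divr_ge0 ?sum_val_ge0// ltW.
have p1 : \sum_c p c = 1 by rewrite -mulr_suml divff// gt_eqF.
have act c : 0 < p c -> [/\ (0 < cn (d c))%N, (0 < cm (d c))%N, (0 < cp (d c))%N
    & forall t u, pi c t = Some u -> 0 < est T rho u].
  by rewrite /p pmulr_lgt0 ?invr_gt0// => /(sum_val_gt0P (d c) (hpat c)).
have V0 c : 0 < p c -> 0 < V c.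
  by move=> /act[n0 m0 q0 _]; rewrite ltr0n !muln_gt0 n0 m0.
have N0' : 0 < N%:R :> R by rewrite ltr0n.
(* The sample space: a class, one of its terms, and a position; given the class, the term and the
   position are uniform. *)
pose G := ({c : 'I_m & term (d c)} * 'I_N)%type.
pose u (g : G) := p (tag g.1) / (V (tag g.1) * N%:R).
pose sg (g : G) := term_at (tagged g.1) g.2.
pose tg c (w : term (d c)) t : G := (Tagged (fun c => term (d c)) w, t).
have u0 g : 0 <= u g by rewrite divr_ge0// mulr_ge0// ler0n.
have annE c (w : term (d c)) : term_annot w \in E c by exact: c_mem.
have sgT g : sg g \in supp T.
  exact: (@supp_tpow _ _ _ N (term_annot (tagged g.1))
    g.2 (fsubsetP (hsub (tag g.1)) _ (annE _ _))).
have sumG f : \sum_g u g * f (sg g)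
    = \sum_c p c / (V c * N%:R) * \sum_(w : term (d c)) \sum_t f (term_at w t).
  rewrite -(pair_bigA _ (fun (h : {c : 'I_m & term (d c)}) (t : 'I_N) =>
      u (h, t) * f (sg (h, t))))/=.
  rewrite -(sig_big_dep xpredT (fun=> xpredT)
     (fun c (w : term (d c)) => \sum_t p c / (V c * N%:R) * f (term_at w t)))/=.
  apply: eq_bigr => c _; rewrite mulr_sumr; apply: eq_bigr => w _.
  by rewrite mulr_sumr.
have u1 : \sum_g u g = 1.
  have := sumG (fun=> 1); under eq_bigr do rewrite mulr1; move=> ->.
  rewrite -[RHS]p1; apply: eq_bigr => c _.
  rewrite !sumr_const !card_prod !card_ord -mulrnA.
  (* A class of probability 0 may have no terms, so [V c] need not be invertible. *)
  have [pc0|pc0] := eqVneq (p c) 0; first by rewrite pc0 !mul0r.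
  have Vc : 0 < V c by apply: V0; rewrite lt_neqAle eq_sym pc0 p0.
  by rewrite natrM -/(V c); move: (V c) Vc => y y0; field; rewrite !gt_eqF.
pose P := law u sg.
have hP : sdist T P by exact: law_sdist.
exists P => //.
have zeroP c (w : term (d c)) t : pi c t = None -> term_at w t \in supp0 T.
  move=> pN; have [[_ _ conf _] _] := hc c; have := conf _ (annE _ w) t.
  by rewrite pN.
have starP c (w : term (d c)) t s : pi c t = Some s -> term_at w t = s.
  move=> pN; have [[_ _ conf _] _] := hc c; have := conf _ (annE _ w) t.
  by rewrite pN.
have ug c (w : term (d c)) t : 0 < p c -> 0 < u (tg c w t).
  by move=> pc; rewrite divr_gt0// mulr_gt0// V0.
(* Annotations of positive probability come from classes of positive value, so their estimates are
   positive and the objective is finite. *)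
have estP s : s \in supp T -> 0 < P s -> 0 < est T rho s.
  move=> sT /(law_gt0P u0)[[[c w] t] ugt hs].
  have pc : 0 < p c.
    rewrite lt_neqAle p0 andbT; apply: contraTneq ugt => pc.
    by rewrite /u /= -pc mul0r ltxx.
  have e : 0 < est T rho (sg (tg c w t)).
    have [_ _ _ he] := act c pc.
    case ep: (pi c t) => [s'|]; first by rewrite /sg /= (starP _ _ _ _ ep) (he _ _ ep).
    by apply: est_gt0_supp0; exact: zeroP.
  by move: e; case: hs => <-; rewrite ?est_rot ?supp_rot.
rewrite (objectiveE hT hP estP) lee_fin ler_pM2r ?invr_gt0 ?ln2_gt0//.
rewrite /P (sum_law hT u sgT).
under eq_bigr do rewrite -gain_potential//.
rewrite -/P (sumG (gain T rho (marginal T P) (dtilde T P))).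
pose wt c (side : {fset annot N} -> {fset {ffun 'I_N -> int}}) :=
  seq_weight (marginal T P) (side (E c)).
have mg0 i : 0 <= marginal T P i by exact: marginal_ge0.
have wt0 c side : 0 <= wt c side.
  by apply: sumr_ge0 => A _; apply: prodr_ge0.
have lawpos c (w : term (d c)) t : 0 < p c -> [/\ 0 < P (term_at w t),
    0 < P (srot (term_at w t)) & 0 < P (srot (srot (term_at w t)))].
  by move=> pc; have := law_gt0 sg u0 (ug c w t pc).
have mpos c (w : term (d c)) t : 0 < p c ->
  [/\ 0 < marginal T P (term_at w t).1.1, 0 < marginal T P (term_at w t).1.2
    & 0 < marginal T P (term_at w t).2].
  move=> pc; have [h1 h2 h3] := lawpos c w t pc.
  have sT : term_at w t \in supp T by exact: (sgT (tg c w t)).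
  split; first exact: marginal_gt0.
    by apply: (@marginal_gt0 P (srot (term_at w t))); rewrite ?supp_rot.
  by apply: (@marginal_gt0 P (srot (srot (term_at w t)))); rewrite ?supp_rot.
(* [class_bound] averaged over the [V c] terms and weighted by [p c]. *)
have cb c : 0 < p c -> p c * ln (sum_val T rho (pi c) (E c)) <=
    p c / V c * (\sum_(w : term (d c)) \sum_t
       gain T rho (marginal T P) (dtilde T P) (term_at w t))
    + p c * ((ln (wt c (@xindices N)) + ln (wt c (@yindices N))
        + ln (wt c (@zindices N))) / 3).
  move=> pc; have [n0 m0 q0 he] := act c pc; have Vc := V0 c pc.
  have [cons coh] := hc c.
  have hcb := class_bound hT hrho (d := d c) (pm := marginal T P) (pt := dtilde T P)
    cons coh n0 m0 q0 he mg0 (fun i => dtilde_ge0 hT i hP) (sum_dtilde_le1 hT hP)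
    (fun w t => mpos c w t pc).
  have {hcb} := hcb _; rewrite -/(V c) => hcb.
  have : V c * ln (sum_val T rho (pi c) (E c)) <=
     \sum_(w : term (d c)) \sum_t gain T rho (marginal T P) (dtilde T P) (term_at w t)
     + V c / 3 * (ln (wt c (@xindices N)) + ln (wt c (@yindices N))
         + ln (wt c (@zindices N))).
    apply: hcb => w t pN /=; have [h1 h2 h3] := lawpos c w t pc.
    have s0 := zeroP c w t pN.
    split.
    - exact: (dtilde_gt0 hT hP s0 h1).
    - move=> e; have [] := dtilde_gt0 hT (s := srot (term_at w t)) hP _ h2 e;
        by rewrite ?supp0_rot.
    - by move=> e; have := dtilde_gt0 hT (s := srot (srot (term_at w t))) hP _ h3 e;
        rewrite !supp0_rot//; apply.
  move: (V c) Vc => y y0 h; have pV : 0 <= p c / y by rewrite divr_ge0 ?ltW.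
  have := ler_wpM2l pV h.
  have -> : p c / y * (y * ln (sum_val T rho (pi c) (E c)))
      = p c * ln (sum_val T rho (pi c) (E c)).
    by field; rewrite gt_eqF.
  move=> /le_trans; apply; rewrite mulrDr lerD2l.
  by rewrite le_eqVlt; apply/orP; left; apply/eqP; field; rewrite gt_eqF.
(* Gibbs' inequality between [p] and the class weights on one side, which total at most 1 because
   distinct classes have disjoint index sequences. *)
have gb (side : {fset annot N} -> {fset {ffun 'I_N -> int}}) :
   (forall c e, c != e -> [disjoint side (E c) & side (E e)]%fset) ->
   (forall c A, A \in side (E c) -> forall t, A t \in indices T) ->
   (forall c, 0 < p c ->
      exists2 A, A \in side (E c) & forall t, 0 < marginal T P (A t)) ->
   \sum_c p c * (ln (wt c side) - ln (p c)) <= 0.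
  move=> hd hI hpos; apply: le_trans (gibbs p0 (fun c => wt0 c side) _) _.
    move=> c /hpos[A AS Apos]; rewrite /wt /seq_weight (bigD1_seq A)/= ?fset_uniq//.
    by rewrite ltr_pwDl ?prodr_gt0//; apply: sumr_ge0 => B _; apply: prodr_ge0.
  rewrite p1 subr_le0; apply: (sum_seq_weight_le1 hd hI) => //.
  by rewrite sum_marginal1.
have wex c : 0 < p c -> exists w : term (d c), True.
  by move=> /act[n0 m0 q0 _]; exists (Ordinal n0, Ordinal m0, Ordinal q0).
have memI c s t : s \in E c -> [/\ s.1.1 t \in indices T, s.1.2 t \in indices T
    & s.2 t \in indices T].
  by move=> sE; have /(mem_indices hT) := supp_tpow t (fsubsetP (hsub c) _ sE).
have gX : \sum_c p c * (ln (wt c (@xindices N)) - ln (p c)) <= 0.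
  apply: gb => [c e /dsides[] //|c A /imfsetP[s /= sE ->] t|c pc].
    by have [] := memI c s t sE.
  have [w _] := wex c pc; exists (term_annot w).1.1; first by
      apply/imfsetP; exists (term_annot w).
  by move=> t; have [] := mpos c w t pc.
have gY : \sum_c p c * (ln (wt c (@yindices N)) - ln (p c)) <= 0.
  apply: gb => [c e /dsides[] //|c A /imfsetP[s /= sE ->] t|c pc].
    by have [] := memI c s t sE.
  have [w _] := wex c pc; exists (term_annot w).1.2; first by
      apply/imfsetP; exists (term_annot w).
  by move=> t; have [] := mpos c w t pc.
have gZ : \sum_c p c * (ln (wt c (@zindices N)) - ln (p c)) <= 0.
  apply: gb => [c e /dsides[] //|c A /imfsetP[s /= sE ->] t|c pc].
    by have [] := memI c s t sE.
  have [w _] := wex c pc; exists (term_annot w).2; first by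
      apply/imfsetP; exists (term_annot w).
  by move=> t; have [] := mpos c w t pc.
(* [p c] is the value of the class divided by [v], so [ln v] is the same difference of logarithms
   for every class of positive probability. *)
have lnv : ln v = \sum_c p c * (ln (sum_val T rho (pi c) (E c)) - ln (p c)).
  rewrite -[LHS]mul1r -p1 mulr_suml; apply: eq_bigr => c _.
  have [->|pc] := eqVneq (p c) 0; first by rewrite !mul0r.
  have sv : 0 < sum_val T rho (pi c) (E c).
    rewrite lt_neqAle sum_val_ge0// andbT eq_sym; apply: contraNneq pc => e.
    by rewrite /p e mul0r.
  by rewrite {3}/p ln_div ?posrE// opprB addrCA subrr addr0.
(* The term [- ln (p c)] is split into thirds, one for each side, to be absorbed by [gX], [gY] and
   [gZ]. *)
have key : ln v <= \sum_c p c / V c * (\sum_(w : term (d c)) \sum_t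
       gain T rho (marginal T P) (dtilde T P) (term_at w t))
    + (\sum_c p c * (ln (wt c (@xindices N)) - ln (p c))
      + \sum_c p c * (ln (wt c (@yindices N)) - ln (p c))
      + \sum_c p c * (ln (wt c (@zindices N)) - ln (p c))) / 3.
  rewrite lnv -!big_split/= mulr_suml -big_split/=; apply: ler_sum => c _.
  have [->|pc] := eqVneq (p c) 0; first by rewrite !mul0r !addr0 mul0r.
  have {}pc : 0 < p c by rewrite lt_neqAle eq_sym pc p0.
  have := cb c pc; rewrite mulrBr; lra.
have {key gX gY gZ} key : ln v <= \sum_c p c / V c * (\sum_(w : term (d c)) \sum_t
       gain T rho (marginal T P) (dtilde T P) (term_at w t)) by lra.
rewrite ler_pdivrMr//; apply: (le_trans key).
rewrite mulr_suml le_eqVlt; apply/orP; left; apply/eqP; apply: eq_bigr => c _.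
have [->|pc] := eqVneq (p c) 0; first by rewrite !mul0r.
have := V0 c; rewrite lt_neqAle eq_sym pc p0 => /(_ isT).
by move: (V c) => y y0; field; rewrite !gt_eqF.
Qed.

End ValueBound.

(** * Existence of a maximizing distribution *)

Section ContinuousFunctions.
Variable R : realType.

Definition xlnx (x : R) : R := x * ln x.

(** For [x = y ^+ 2] this reduces to [ln (y^-1) <= y^-1]; for [x <= 0] the logarithm is 0 by
    convention. It gives continuity of [xlnx] at 0. *)
Lemma abs_xlnx_le (x : R) : x <= 1 -> `|x * ln x| <= 2 * Num.sqrt x.
Proof.
move=> x1; have [x0|x0] := leP x 0; first by
    rewrite ln0// mulr0 normr0 mulr_ge0 ?sqrtr_ge0.
rewrite ler0_norm; last by rewrite mulr_ge0_le0 ?ln_le0// ltW.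
set y := Num.sqrt x; have y0 : 0 < y by rewrite sqrtr_gt0.
have -> : x = y ^+ 2 by rewrite sqr_sqrtr// ltW.
have := ln_sublinear (_ : 0 < y^-1); rewrite invr_gt0 => /(_ y0).
rewrite lnV ?posrE// lnXn// => h.
have : y ^+ 2 * (- ln y) <= y ^+ 2 * y^-1 by rewrite ler_wpM2l ?sqr_ge0// ltW.
rewrite expr2 mulfK ?gt_eqF// -mulr_natr; lra.
Qed.

Lemma continuous_xlnx : continuous xlnx.
Proof.
rewrite /xlnx => x; have [x0|x0|->] := ltgtP x 0.
- rewrite /continuous_at ln0 ?mulr0; last exact: ltW.
  apply: cvg_near_cst; near=> y; rewrite ln0 ?mulr0//.
  by apply: ltW; near: y; exact: lt_nbhsl.
- by apply: cvgM; [exact: cvg_id|exact: continuous_ln].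
- rewrite /continuous_at mul0r.
  have h : 2 * Num.sqrt y @[y --> nbhs (0 : R)] --> (0 : R).
    rewrite -[X in _ --> X](mulr0 2) -[X in 2 * X](sqrtr0 R).
    by apply: cvgMr; exact: sqrt_continuous.
  apply: (@squeeze_cvgr _ _ _ _ (fun y => - (2 * Num.sqrt y))
      (fun y => 2 * Num.sqrt y)) => //.
    near=> y; rewrite -ler_norml; apply: abs_xlnx_le; apply: ltW.
    by near: y; exact: lt_nbhsl.
  by rewrite -[X in _ --> X](oppr0); exact: cvgN.
Unshelve. all: by end_near. Qed.

Lemma continuous_sum_seq (V : topologicalType) (I : Type) (r : seq I)
    (f : I -> V -> R) :
  (forall i, continuous (f i)) -> continuous (fun v => \sum_(i <- r) f i v).
Proof.
move=> cf; elim: r => [|i r IH] v.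
  by under eq_fun do rewrite big_nil; exact: cst_continuous.
under eq_fun do rewrite big_cons.
by apply: cvgD; [exact: cf|exact: IH].
Qed.

Lemma closed_fun_eq (V : topologicalType) (f : V -> R) (c : R) :
  continuous f -> closed [set v | f v = c].
Proof.
by move=> cf; apply: (@preimage_closed _ _ f [set x | x = c]) => //; exact: closed_eq.
Qed.

Lemma closed_fun_ge (V : topologicalType) (f : V -> R) (c : R) :
  continuous f -> closed [set v | c <= f v].
Proof.
by move=> cf; apply: (@preimage_closed _ _ f [set x | c <= x]) => //; exact: closed_ge.
Qed.

End ContinuousFunctions.

Section Maximum.
Variables (F : fieldType) (R : realType) (T : estimated F R).
Hypothesis hT : classC T.
Variable rho : R.
Hypothesis hrho : 2 <= rho <= 3.

(** The distributions with finite objective: a charged annotation whose estimate vanishes would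
    contribute -oo. *)
Definition feasible : set (int * int * int -> R) :=
  [set P | sdist T P /\ forall s, s \in supp T -> est T rho s <= 0 -> P s = 0].

Let functional (c P : int * int * int -> R) := \sum_(s <- supp T) P s * c s.

(** The objective in terms of linear functionals and [xlnx] only. As [dtilde] is [excess] over
    [2 / 3 * mass0], its entropy term becomes a difference of [xlnx] values without division, hence
    continuous also where [mass0] is 0. *)
Definition plain_objective (P : int * int * int -> R) : R :=
  (functional (fun s => ln (est T rho s)) P
  - \sum_(i <- indices T) xlnx (functional (fun s => (s.1.1 == i)%:R) P)
  - (rho - 2) / 2 * (\sum_(i <- indices0 T)
        xlnx (functional (excess_coef T i) P)
      - xlnx (functional (fun s => 2 / 3 * (s \in supp0 T)%:R) P))) / ln 2.

Lemma objective_plain P : feasible P -> objective T rho P = (plain_objective P)%:E.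
Proof.
move=> [hP hz]; have [P0 _ _ _] := hP.
have estP s : s \in supp T -> 0 < P s -> 0 < est T rho s.
  move=> sT Ps; rewrite ltNge; apply/negP => /(hz s sT) e.
  by move: Ps; rewrite e ltxx.
rewrite (objectiveE hT hP estP) /plain_objective; congr ((_ / _)%:E).
have mE i : functional (fun s => (s.1.1 == i)%:R) P = marginal T P i.
  rewrite /functional /marginal [RHS]big_mkcond; apply: eq_bigr => s _ /=.
  by case: eqP; rewrite ?mulr1 ?mulr0.
have m0E : functional (fun s => 2 / 3 * (s \in supp0 T)%:R) P = 2 / 3 * mass0 T P.
  rewrite /functional /mass0 sum_supp0// mulr_sumr; apply: eq_bigr => s _ /=.
  by case: ifP; rewrite ?mulr1 ?mulr0// mulrC.
have eE i : functional (excess_coef T i) P = excess T P i by rewrite excessE.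
under [X in _ - X - _]eq_bigr do rewrite mE.
under [X in _ * (X - _)]eq_bigr do rewrite eE.
rewrite m0E /xlnx /=.
have hdt := mass0_entropy_dtilde hT P.
have -> : \sum_(s <- supp T) P s * potential T rho P s =
   functional (fun s => ln (est T rho s)) P
   - \sum_(s <- supp T) P s * ln (marginal T P s.1.1)
   - (rho - 2) / 2 * \sum_(s <- supp T) P s *
      (if s \in supp0 T then ln (dtilde T P s.1.1) - ln (dtilde T P 0) / 3 else 0).
  rewrite mulr_sumr -!sumrB; apply: eq_bigr => s _; rewrite /potential.
  by move: (if _ then _ else _) => x; ring.
congr (_ - _ - _ * _).
  by rewrite -(sum_marginal hT P (fun i => ln (marginal T P i)) (fsubset_refl _)).
rewrite -(sum_excess hT P (fun i => ln (dtilde T P i))).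
rewrite -(sum_excess1 hT) mulr_suml -sumrB; apply: eq_bigr => i _.
have [e0|e0] := eqVneq (excess T P i) 0; first by rewrite e0 !mul0r subr0.
have ep : 0 < excess T P i by rewrite lt_neqAle eq_sym e0 excess_ge0.
have mp : 0 < mass0 T P.
  rewrite lt_neqAle eq_sym mass0_ge0// andbT; apply: contraNneq e0 => m0.
  rewrite excessE// big_seq big1// => s sT; rewrite /excess_coef; case: ifP => s0;
      rewrite ?mulr0//.
  have /eqP : mass0 T P = 0 by [].
  rewrite /mass0 (bigD1_seq s)/= ?fset_uniq// paddr_eq0 ?P0 ?sumr_ge0//.
  by move=> /andP[/eqP -> _]; rewrite mul0r.
rewrite -mulrBr; congr (_ * _).
rewrite sum_excess1 // dtildeE// -ln_div ?posrE ?mulr_gt0//; congr (ln _); field.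
by rewrite gt_eqF.
Qed.

Lemma max_feasible : feasible !=set0 -> exists2 P, feasible P &
  forall Q, feasible Q -> (objective T rho Q <= objective T rho P)%E.
Proof.
move=> [P0 hP0]; pose n := #|{: supp T}|.
(* Distributions are encoded as row vectors with coordinates indexed by the support; [dist] extends
   them by 0. *)
pose dist (v : 'rV[R]_n) s : R :=
  if insub s : option (supp T) is Some s' then v ord0 (enum_rank s') else 0.
pose row (P : int * int * int -> R) : 'rV[R]_n := \row_i P (val (enum_val i)).
have rowK P : sdist T P -> dist (row P) = P.
  move=> [_ PT _ _]; apply: funext => s; rewrite /dist; case: insubP => [s' _ <-|sT].
    by rewrite mxE enum_rankK.
  by rewrite PT.
have cd s : continuous (fun v => dist v s).
  rewrite /dist; case: insubP => [s' _ _|_] v; last exact: cst_continuous.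
  exact: coord_continuous.
have cf c : continuous (fun v => functional c (dist v)).
  by apply: continuous_sum_seq => s v;
      apply: continuousM; [exact: cd|exact: cst_continuous].
have cxf c : continuous (fun v => xlnx (functional c (dist v))).
  by move=> v; apply: (@continuous_comp _ _ _
      (fun v => functional c (dist v)) (@xlnx R) v);
    [exact: cf|exact: continuous_xlnx].
pose marginals (v : 'rV[R]_n) :=
  \sum_(i <- indices T) xlnx (functional (fun s => (s.1.1 == i)%:R) (dist v)).
pose excesses (v : 'rV[R]_n) :=
  \sum_(i <- indices0 T) xlnx (functional (excess_coef T i) (dist v)).
have cm : continuous marginals by apply: continuous_sum_seq => i; exact: cxf.
have ce : continuous excesses by apply: continuous_sum_seq => i; exact: cxf.
have cobj : continuous (fun v => plain_objective (dist v)).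
  have cst (k : R) (v : 'rV[R]_n) : {for v, continuous (fun _ : 'rV[R]_n => k)}.
    exact: cst_continuous.
  by move=> v; exact: (continuousM (continuousB (continuousB (cf _ v) (cm v))
    (continuousM (cst ((rho - 2) / 2) v) (continuousB (ce v) (cxf _ v))))
    (cst (ln 2)^-1 v)).
pose K := [set v : 'rV[R]_n | feasible (dist v)].
have KE : K = (\bigcap_(s in setT) [set v | 0 <= dist v s])
   `&` [set v | functional (fun=> 1) (dist v) = 1]
   `&` (\bigcap_(s in setT) [set v | dist v s - dist v (srot s) = 0])
   `&` (\bigcap_(s in [set s | s \in supp T /\ est T rho s <= 0])
        [set v | dist v s = 0]).
  apply/seteqP; split=> v /=.
    move=> [[d0 dT d1 dr] dz]; split; last by move=> s [sT es]; exact: dz.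
    split; last by move=> -[[i j] k] _ /=; rewrite /srot /= dr subrr.
    split; first by move=> s _; exact: d0.
    by rewrite /functional; under eq_bigr do rewrite mulr1.
  move=> [[[d0 d1] dr] dz]; split; last by move=> s sT es; apply: dz.
  split.
  - by move=> s; exact: d0.
  - by move=> s sT; rewrite /dist insubN.
  - by move: d1; rewrite /functional; under eq_bigr do rewrite mulr1.
  - by move=> i j k; apply/eqP; rewrite -subr_eq0; apply/eqP; exact: (dr (i, j, k)).
have Kcl : closed K.
  rewrite KE; repeat apply: closedI.
  - by apply: closed_bigI => s _; exact: closed_fun_ge.
  - exact: closed_fun_eq.
  - by apply: closed_bigI => s _; apply: closed_fun_eq => v; apply: continuousB;
      exact: cd.
  - by apply: closed_bigI => s _; exact: closed_fun_eq.
(* Nonnegative coordinates with sum 1 lie in [0, 1], so [K] is a closed subset of a compact cube. *)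
have Kc : compact K.
  apply: (@subclosed_compact _ K [set v : 'rV[R]_n | forall i, `[0, 1]%classic (v ord0 i)]) => //.
    by apply: (@rV_compact R n (fun=> `[0, 1]%classic)) => i; exact: segment_compact.
  move=> v [[d0 dT d1 dr] dz] i /=.
  have e : v ord0 i = dist v (val (enum_val i)).
    by rewrite /dist valK enum_valK.
  rewrite in_itv/= e d0 /= -d1 (bigD1_seq (val (enum_val i)))/= ?fset_uniq ?valP//.
  by rewrite lerDl; apply: sumr_ge0.
have K0 : K !=set0.
  by exists (row P0); rewrite /K /= rowK //; case: hP0.
have [v vK vmax] := compact_EVT_max K0 Kc (continuous_subspaceT cobj).
exists (dist v); first by move: vK; rewrite inE.
have fv : feasible (dist v) by move: vK; rewrite inE.
move=> Q hQ; rewrite !objective_plain// lee_fin.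
have := vmax (row Q); rewrite !rowK//; last by case: hQ.
by apply; rewrite inE /K /= rowK //; case: hQ.
Qed.

End Maximum.

(** * Attainment of the maximum and passage to the limit *)

Section MaximumOverAll.
Variables (F : fieldType) (R : realType) (T : estimated F R).
Hypothesis hT : classC T.
Variable rho : R.
Hypothesis hrho : 2 <= rho <= 3.

Lemma objective_infeasible P : sdist T P -> ~ feasible T rho P ->
  objective T rho P = -oo%E.
Proof.
move=> hP nf; have [P0 _ _ _] := hP.
have [s sT [es Ps]] : exists2 s, s \in supp T & est T rho s <= 0 /\ P s != 0.
  apply: contrapT => h; apply: nf; split=> // s sT es.
  by apply/eqP; apply: contrapT => /negP Ps; apply: h; exists s.
rewrite /objective; set S := (\sum_(s <- supp T) _)%E.
have -> : S = -oo%E.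
  apply/esum_eqNyP; exists s; split=> //.
  rewrite elog2_le0// gt0_muleNy// lte_fin lt_neqAle eq_sym; apply/andP.
  by split.
by rewrite addeNy addNye.
Qed.

Lemma sdist_nonempty : supp T != fset0 -> exists P, sdist T P.
Proof.
move=> ne; pose k : R := #|` supp T|%:R.
have k0 : k != 0 by rewrite pnatr_eq0 cardfs_eq0.
exists (fun s => if s \in supp T then k^-1 else 0); split.
- by move=> s; case: ifP => // _; rewrite invr_ge0 ler0n.
- by move=> s /negbTE ->.
- rewrite big_seq (eq_bigr (fun=> k^-1)); last by move=> s ->.
  rewrite -big_seq big_const_seq count_predT iter_addr_0 -mulr_natr.
  by rewrite mulVf.
- by move=> i j k'; rewrite (supp_rot hT (i, j, k')).
Qed.

(** A maximizer among the feasible distributions is one overall; if none is feasible, the objective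
    is -oo throughout and any distribution will do. *)
Lemma objective_max : supp T != fset0 ->
  exists2 P, sdist T P & objective T rho P = ereal_sup (objective T rho @` sdist T).
Proof.
move=> ne; suff [P hP Pmax] : exists2 P, sdist T P &
    forall Q, sdist T Q -> (objective T rho Q <= objective T rho P)%E.
  exists P => //; apply/eqP; rewrite eq_le; apply/andP; split.
    by apply: ereal_sup_ubound; exists P.
  by apply: ge_ereal_sup => _ [Q hQ <-]; exact: Pmax.
have [fe|fe] := pselect (feasible T rho !=set0).
  have [P hP Pmax] := max_feasible hT fe.
  exists P; first by case: hP.
  move=> Q hQ; have [fQ|fQ] := pselect (feasible T rho Q); first exact: Pmax.
  by rewrite objective_infeasible// leNye.
have [P hP] := sdist_nonempty ne; exists P => // Q hQ.
rewrite objective_infeasible ?leNye// => fQ.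
by apply: fe; exists Q.
Qed.

Lemma coherent_value_at_ge0 N : 0 <= coherent_value_at T N rho.
Proof.
rewrite /coherent_value_at; set A := [set v | _].
have [hs|ns] := pselect (has_sup A); last by rewrite sup_out.
have [[v Av] ub] := hs; have vs := sup_upper_bound hs Av; apply: le_trans vs.
move: Av => [m [E [pi [[RX [RY [RZ [_ _ _ _ hc]]]] ->]]]].
by apply: sumr_ge0 => c _; apply: sum_val_ge0 => //; have [[_ ? _ _] _] := hc c.
Qed.

Lemma coherent_value_at_le N (b : R) : (0 < N)%N -> 0 <= b ->
  (forall P, sdist T P -> forall x : R, (x%:E <= objective T rho P)%E ->
    expR (x * ln 2) <= b) ->
  coherent_value_at T N rho `^ N%:R^-1 <= b.
Proof.
move=> N0 b0 hb; have Nr : 0 < N%:R :> R by rewrite ltr0n.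
have -> : b = (b ^+ N) `^ N%:R^-1.
  rewrite -powR_mulrn// -powRrM divff ?gt_eqF// powRr1//.
apply: ge0_ler_powR; rewrite ?invr_ge0 ?nnegrE ?coherent_value_at_ge0 ?exprn_ge0//;
    rewrite ?ler0n//.
rewrite /coherent_value_at; set A := [set v | _].
have [hs|ns] := pselect (has_sup A); last by rewrite sup_out// exprn_ge0.
apply: ge_sup; first by case: hs.
move=> _ [m [E [pi [hres ->]]]]; set v := \sum_c _.
have [v0|v0] := leP v 0; first by rewrite (le_trans v0)// exprn_ge0.
have [P hP /(hb P hP) hv] := value_bound hT hrho N0 hres v0.
have -> : v = expR (ln v / N%:R / ln 2 * ln 2) ^+ N.
  rewrite -expRM_natr -{1}[v]lnK ?posrE//; congr expR.
  by field; rewrite !gt_eqF// ln2_gt0.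
by rewrite lerXn2r// nnegrE// expR_ge0.
Qed.

Lemma coherent_value_le (b : R) : 0 <= b ->
  (forall P, sdist T P -> forall x : R, (x%:E <= objective T rho P)%E ->
    expR (x * ln 2) <= b) ->
  coherent_value T rho <= b.
Proof.
move=> b0 hb; rewrite /coherent_value.
have [cv|dv] := pselect (cvgn (fun N => coherent_value_at T N rho `^ N%:R^-1)).
  apply: limr_le => //; near=> N; apply: coherent_value_at_le => //.
  by near: N; exact: nbhs_infty_gt.
by rewrite (dvgP dv).
Unshelve. all: by end_near. Qed.

End MaximumOverAll.

(** The maximum is a supremum of extended reals, attained once [supp T] is nonempty; for empty
    support [sdist T] is empty and the supremum is -oo. *)
Theorem mainTheorem11 (F : fieldType) (R : realType) (T : estimated F R)
    (hT : classC T) (rho : R) (hrho : 2 <= rho <= 3) :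
  (elog2 (coherent_value T rho) <= ereal_sup (objective T rho @` sdist T))%E /\
  (supp T != fset0 ->
    exists2 P, sdist T P & objective T rho P = ereal_sup (objective T rho @` sdist T)).
Proof.
split; last exact: objective_max.
have ubM P : sdist T P
    -> (objective T rho P <= ereal_sup (objective T rho @` sdist T))%E.
  by move=> hP; apply: ereal_sup_ubound; exists P.
move: (ereal_sup _) ubM => [r| |] ubM; last 2 first.
- by rewrite leey.
(* Every objective is -oo here, so the coherent value is bounded by 0. *)
- rewrite elog2_le0//; apply: coherent_value_le => // P /ubM h x hx.
  by have := le_trans hx h; rewrite leeNy_eq.
have le_cv : coherent_value T rho <= expR (r * ln 2).
  apply: coherent_value_le => //.
  move=> P /ubM h x hx; have := le_trans hx h; rewrite lee_fin => xr.
  by rewrite ler_expR ler_wpM2r// ltW// ln2_gt0.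
have [cv0|cv0] := leP (coherent_value T rho) 0; first by rewrite elog2_le0// leNye.
rewrite elog2_gt0// lee_fin ler_pdivrMr ?ln2_gt0// -[leRHS]expRK.
by rewrite ler_ln ?posrE ?expR_gt0.
Qed.
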